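(* Let $d\ge1$, $\eta>(d-1)/2$, $\omega_{d,\eta}>0$, $\Sigma\in\mathbb{S}_d^+$, and let $g_{\eta,\Sigma}$ be the Lévy density of $A\Gamma_d(\eta,\Sigma)$, $$g_{\eta,\Sigma}(X)=\frac{c_{d,\eta}}{|\Sigma|^\eta}\frac{e^{-\mathrm{tr}(\Sigma^{-1}X)}}{[\mathrm{tr}(\Sigma^{-1}X)]^{\eta d}}|X|^{\eta-(d+1)/2},\quad X>0,\qquad c_{d,\eta}=\omega_{d,\eta}\frac{\Gamma(\eta d)}{\Gamma_d(\eta)}.$$ Let $W$ be a random matrix with Wishart distribution $W_d(2\eta,\Sigma)$. For any integer $p>0$ the following three identities hold: a) $\displaystyle\int_{X>0}X^p g_{\eta,\Sigma}(X)\,\mathrm{d}X=\frac{\omega_{d,\eta}}{2^p}\mathrm{B}(\eta d,p)\,\mathbb{E}W^p.$ b) $\displaystyle\int_{X>0}X^{\otimes p}g_{\eta,\Sigma}(X)\,\mathrm{d}X=\frac{\omega_{d,\eta}}{2^p}\mathrm{B}(\eta d,p)\,\mathbb{E}(W^{\otimes p}).$ c) $\displaystyle\int_{X>0}|X|^p g_{\eta,\Sigma}(X)\,\mathrm{d}X=\frac{\omega_{d,\eta}}{2^{pd}}\mathrm{B}(\eta d,pd)\,\mathbb{E}(|W|^p)=\omega_{d,\eta}\,\Gamma_d(p)\,\frac{\mathrm{B}(\eta d,pd)}{\mathrm{B}_d(\eta,p)}\,|\Sigma|^p.$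
   Context: $\mathbb{S}_d^+$ is the open cone of positive definite symmetric real $d\times d$ matrices; $X>0$ means $X\in\mathbb{S}_d^+$; $|X|$ is the determinant; $X^p$ is the matrix power and $X^{\otimes p}$ the $p$-fold tensor (Kronecker) product. $\mathrm{d}X$ is Lebesgue measure on symmetric matrices identified with $\mathbb{R}^{d(d+1)/2}$. The multivariate Gamma function is $\Gamma_d(\eta)=\int_{X>0}e^{-\mathrm{tr}(X)}|X|^{\eta-(d+1)/2}\mathrm{d}X$ for $\operatorname{Re}(\eta)>(d-1)/2$, with alternative expression $\Gamma_d(\eta)=\pi^{d(d-1)/4}\prod_{i=1}^d\Gamma(\eta-\frac12(i-1))$; $\Gamma$ is the usual Gamma function. The Beta function is $\mathrm{B}(n,m)=\Gamma(n)\Gamma(m)/\Gamma(n+m)$, and the multivariate Beta function is $\mathrm{B}_d(n,m)=\Gamma_d(n)\Gamma_d(m)/\Gamma_d(n+m)$, both written for $\operatorname{Re}(n)>0$, $\operatorname{Re}(m)>0$. $A\Gamma_d(\eta,\Sigma)$ (with given constant $\omega_{d,\eta}>0$) is the infinitely divisible distribution on positive definite matrices, without drift or Gaussian part, with Lévy measure $g_{\eta,\Sigma}(X)\mathrm{d}X$ on $\mathbb{S}_d^+$. The Wishart distribution $W_d(n,\Sigma)$, $n>d-1$, $\Sigma\in\mathbb{S}_d^+$, is the distribution on $\mathbb{S}_d^+$ with density $f_W(A)=\frac{1}{2^{dn/2}\Gamma_d(n/2)|\Sigma|^{n/2}}e^{-\frac12\mathrm{tr}(\Sigma^{-1}A)}|A|^{(n-d-1)/2}$,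 $A>0$.
   Formalization: In c) the last expression, with Γ_d(p)/B_d(η,p), is claimed only for p>(d-1)/2, since Γ_d(p) is undefined (a pole) for integers p≤(d-1)/2; for every p>0 the identity is given with Γ_d(η+p)/Γ_d(η) in place of Γ_d(p)/B_d(η,p). *)

(* Defs.v *)
From HB Require Import structures.
From mathcomp Require Import all_boot all_order all_algebra.
From mathcomp Require Import all_classical all_reals all_analysis.
From mathcomp.real_closed Require mxtens.

Set Implicit Arguments.
Unset Strict Implicit.
Unset Printing Implicit Defensive.

Import Order.TTheory GRing.Theory Num.Theory.
Import numFieldNormedType.Exports.

Local Open Scope classical_set_scope.
Local Open Scope ring_scope.

Definition measure_matrix_display : measure_display -> measure_display.
Proof. exact. Qed.

(* As for [n.-tuple T], matrices carry the sigma-algebra generated by their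
   entries (the Borel sigma-algebra when the entries are real). *)
Section measurable_matrix.
Context {d} {T : measurableType d} (m n : nat).

Definition mx_measurable : set (set 'M[T]_(m, n)) :=
  <<s \bigcup_(ij in [set: 'I_m * 'I_n])
        preimage_set_system setT (fun M : 'M[T]_(m, n) => M ij.1 ij.2)
          measurable >>.

Let mx_measurable0 : mx_measurable set0.
Proof. exact: sigma_algebra0. Qed.

Let mx_measurableC A : mx_measurable A -> mx_measurable (~` A).
Proof. exact: sigma_algebraC. Qed.

Let mx_measurable_bigcup (F : (set 'M[T]_(m, n))^nat) :
  (forall i, mx_measurable (F i)) -> mx_measurable (\bigcup_i F i).
Proof. exact: sigma_algebra_bigcup. Qed.

HB.instance Definition _ := @isMeasurable.Build (measure_matrix_display d)
  'M[T]_(m, n) mx_measurable mx_measurable0 mx_measurableC mx_measurable_bigcup.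

Lemma measurable_entry (i : 'I_m) (j : 'I_n) :
  measurable_fun [set: 'M[T]_(m, n)] (fun M => M i j).
Proof.
move=> _ Y mY; apply: sub_sigma_algebra; exists (i, j) => //=.
by exists Y.
Qed.

Lemma measurable_fun_mx d' (T' : measurableType d') (f : T' -> 'M[T]_(m, n)) :
  (forall i j, measurable_fun [set: T'] (fun x => f x i j)) ->
  measurable_fun [set: T'] f.
Proof.
move=> mf; apply: (@measurability _ _ _ _ _ _
  (\bigcup_(ij in [set: 'I_m * 'I_n])
        preimage_set_system setT (fun M : 'M[T]_(m, n) => M ij.1 ij.2)
          measurable)) => //.
move=> _ [_ [[i j] _ [Y mY <-]] <-] /=.
by rewrite setTI; exact: mf.
Qed.

End measurable_matrix.

Section lebesgue_tuple.
Context {R : realType}.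
Local Open Scope ereal_scope.

Section tuple_cons_measure.
Context (n : nat) (mu : {sigma_finite_measure set (n.-tuple R) -> \bar R}).

Definition tuple_cons (x : measurableTypeR R * n.-tuple R) : n.+1.-tuple R :=
  [the n.+1.-tuple R of (x.1 : R) :: x.2].

Lemma measurable_tuple_cons : measurable_fun setT tuple_cons.
Proof. exact: measurable_cons. Qed.

Definition tuple_cons_measure : set (n.+1.-tuple R) -> \bar R :=
  pushforward (lebesgue_measure \x mu) tuple_cons.

Let nu : {measure set (n.+1.-tuple R) -> \bar R} :=
  measure_function_pushforward__canonical__measure_function_Measure
    (lebesgue_measure \x mu) measurable_tuple_cons.

Let tuple_cons_measure0 : tuple_cons_measure set0 = 0.
Proof. exact: (measure0 nu). Qed.

Let tuple_cons_measure_ge0 A : 0 <= tuple_cons_measure A.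
Proof. exact: (measure_ge0 nu). Qed.

Let tuple_cons_measure_sigma_additive : semi_sigma_additive tuple_cons_measure.
Proof. exact: (@measure_semi_sigma_additive _ _ _ nu). Qed.

HB.instance Definition _ := isMeasure.Build _ _ _ tuple_cons_measure
  tuple_cons_measure0 tuple_cons_measure_ge0 tuple_cons_measure_sigma_additive.

Let tuple_cons_measure_sigma_finite : sigma_finite setT tuple_cons_measure.
Proof.
have [F FT Foo] : sigma_finite setT (lebesgue_measure \x mu).
  have /sigma_finiteP[A [AT ndA Aoo]] := sigma_finiteT (@lebesgue_measure R).
  have /sigma_finiteP[B [BT ndB Boo]] := sigma_finiteT mu.
  exists (fun k => A k `*` B k).
    rewrite -setXTT AT BT predeqE => -[x y]; split.
      move=> [/= [i _ Aix] [k _ Bky]]; exists (maxn i k) => //; split.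
      - by move: x Aix; exact/subsetPset/ndA/leq_maxl.
      - by move: y Bky; exact/subsetPset/ndB/leq_maxr.
    by move=> [i _ []/= ? ?]; split; exists i.
  move=> k; have [? ?] := Aoo k; have [? ?] := Boo k.
  split; first exact: measurableX.
  by rewrite product_measure1E// lte_mul_pinfty// ge0_fin_numE.
pose g (t : n.+1.-tuple R) : measurableTypeR R * n.-tuple R :=
  (thead t : measurableTypeR R, [tuple of behead t]).
have gK : cancel tuple_cons g.
  by move=> [x t]; rewrite /g theadE; congr pair; exact/val_inj.
have mg : measurable_fun setT g.
  apply/measurable_fun_pairP; split; last exact: measurable_behead.
  exact: (measurable_tnth (T := R) ord0).
exists (fun k => g @^-1` F k).
  by rewrite -preimage_bigcup -FT preimage_setT.
move=> k; have [mF Fk] := Foo k; split.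
  by rewrite -[X in measurable X]setTI; exact: mg.
rewrite /tuple_cons_measure /pushforward -comp_preimage.
by rewrite (_ : g \o tuple_cons = id)//; apply/funext => x; exact: gK.
Qed.

HB.instance Definition _ := Measure_isSigmaFinite.Build _ _ _
  tuple_cons_measure tuple_cons_measure_sigma_finite.

End tuple_cons_measure.

(* n-dimensional Lebesgue measure: the n-fold product of [lebesgue_measure] *)
Fixpoint lebesgue_tuple (n : nat) :
    {sigma_finite_measure set (n.-tuple R) -> \bar R} :=
  if n is n'.+1 return {sigma_finite_measure set (n.-tuple R) -> \bar R}
  then tuple_cons_measure (lebesgue_tuple n')
  else \d_ [tuple].

End lebesgue_tuple.

Section symmetric_matrices.
Context {R : realType}.

(* The entry of index (i, j), i <= j, is coordinate number j(j+1)/2 + i. *)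
Definition sym_of_tuple (d : nat) (v : (d * d.+1)./2.-tuple R) : 'M[R]_d :=
  \matrix_(i, j) v`_((maxn i j * (maxn i j).+1)./2 + minn i j)%N.

Lemma sym_of_tuple_index (d : nat) (i j : 'I_d) :
  ((maxn i j * (maxn i j).+1)./2 + minn i j < (d * d.+1)./2)%N.
Proof.
have md : (maxn i j < d)%N by rewrite gtn_max !ltn_ord.
apply: (@leq_trans ((maxn i j).+1 * (maxn i j).+2)./2); last first.
  by rewrite half_leq// leq_mul.
have -> : ((maxn i j).+1 * (maxn i j).+2 =
    maxn i j * (maxn i j).+1 + (maxn i j).+1.*2)%N.
  by rewrite -mul2n -mulnDl addn2 mulnC.
by rewrite halfD odd_double andbF add0n doubleK ltn_add2l ltnS geq_min leq_max
  leqnn.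
Qed.

Lemma measurable_sym_of_tuple (d : nat) :
  measurable_fun setT (@sym_of_tuple d).
Proof.
apply: measurable_fun_mx => i j.
rewrite (_ : (fun v => _) =
    (fun v : _.-tuple R => tnth v (Ordinal (sym_of_tuple_index i j)))).
  exact: measurable_tnth.
by apply/funext => v; rewrite mxE (tnth_nth 0).
Qed.

(* Lebesgue measure on symmetric matrices: the image of the Lebesgue measure
   of R^(d(d+1)/2), seen as a measure on all matrices carried by the symmetric
   ones. *)
Definition lebesgue_sym (d : nat) : set 'M[R]_d -> \bar R :=
  pushforward (lebesgue_tuple (d * d.+1)./2) (@sym_of_tuple d).

Let nu d : {measure set 'M[R]_d -> \bar R} :=
  measure_function_pushforward__canonical__measure_function_Measure
    (lebesgue_tuple (d * d.+1)./2) (@measurable_sym_of_tuple d).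

HB.instance Definition _ (d : nat) :=
  isMeasure.Build _ _ _ (@lebesgue_sym d) (measure0 (nu d)) (measure_ge0 (nu d))
    (@measure_semi_sigma_additive _ _ _ (nu d)).

End symmetric_matrices.

Arguments lebesgue_sym {R} d.

Section special_functions.
Context {R : realType}.

Definition posdef (d : nat) : set 'M[R]_d :=
  [set X | X^T = X /\ forall v : 'cV[R]_d, v != 0 -> 0 < (v^T *m X *m v) 0 0].
Arguments posdef : clear implicits.

(* The integrals defining Gamma and mvGamma converge for 0 < a and
   (d - 1) / 2 < a respectively; outside these ranges the values are junk. *)
Definition Gamma (a : R) : R :=
  \int[lebesgue_measure]_(x in `]0, +oo[) (expR (- x) * x `^ (a - 1)).

Definition mvGamma (d : nat) (a : R) : R :=
  \int[lebesgue_sym d]_(X in posdef d)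
    (expR (- \tr X) * \det X `^ (a - (d%:R + 1) / 2)).

Definition Beta (a b : R) : R := Gamma a * Gamma b / Gamma (a + b).

(* For b <= (d - 1) / 2 the value [mvGamma d b] is junk, and so is [mvBeta d a b];
   the quotient mvGamma d b / mvBeta d a b then stands for
   mvGamma d (a + b) / mvGamma d a. *)
Definition mvBeta (d : nat) (a b : R) : R :=
  mvGamma d a * mvGamma d b / mvGamma d (a + b).

End special_functions.

Arguments posdef {R} d.

Section AGamma_Wishart.
Context {R : realType} (d : nat).

Definition AGamma_cst (eta omega : R) : R :=
  omega * (Gamma (eta * d%:R) / mvGamma d eta).

Definition AGamma_levy_density (eta omega : R) (Sigma X : 'M[R]_d) : R :=
  AGamma_cst eta omega / \det Sigma `^ eta *
  (expR (- \tr (invmx Sigma *m X)) /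
   (\tr (invmx Sigma *m X)) `^ (eta * d%:R)) *
  \det X `^ (eta - (d%:R + 1) / 2).

Definition Wishart_density (n : R) (Sigma A : 'M[R]_d) : R :=
  (2 `^ (d%:R * n / 2) * mvGamma d (n / 2) * \det Sigma `^ (n / 2))^-1 *
  expR (- (1 / 2) * \tr (invmx Sigma *m A)) *
  \det A `^ ((n - d%:R - 1) / 2).

Definition is_Wishart (dT : measure_display) (T : measurableType dT)
    (P : probability T R) (W : {RV P >-> 'M[R]_d}) (n : R) (Sigma : 'M[R]_d) :=
  forall A : set 'M[R]_d, measurable A ->
    distribution P W A =
    (\int[lebesgue_sym d]_(X in A `&` posdef d)
       (Wishart_density n Sigma X)%:E)%E.

End AGamma_Wishart.

Section matrix_integrals.
Context {R : realType} (dT : measure_display) (T : measurableType dT).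

Definition mx_integrable (mu : {measure set T -> \bar R}) (D : set T)
    (m n : nat) (F : T -> 'M[R]_(m, n)) : Prop :=
  forall i j, mu.-integrable D (fun x => (F x i j)%:E).

Definition mx_integral (mu : {measure set T -> \bar R}) (D : set T)
    (m n : nat) (F : T -> 'M[R]_(m, n)) : 'M[R]_(m, n) :=
  \matrix_(i, j) \int[mu]_(x in D) F x i j.

Definition mx_expectation (P : probability T R) (m n : nat)
    (F : T -> 'M[R]_(m, n)) : 'M[R]_(m, n) :=
  \matrix_(i, j) fine 'E_P[fun w => F w i j].

End matrix_integrals.

(* Main.v *)
(** Let s(X) = tr(Sigma^-1 X), a = eta d, and let h be measurable and homogeneous
of degree k on the positive definite cone. Substituting X = (1 + t)^-1 Y in the
t-integral 1/Gamma(a) * int_0^oo t^(a-1) e^(-ts) dt = s^-a gives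
<<
  int h e^-s s^-a |X|^(eta-(d+1)/2) dX =
    (B(a, k) / Gamma(a)) * int h e^-s |X|^(eta-(d+1)/2) dX,
>>
and the right-hand side is a multiple of the Wishart expectation of h. The entries
of X^p and of the p-th tensor power of X are such h with k = p, and |X|^p is one
with k = pd. For the determinant, the congruence X |-> C X C^T, Sigma = C C^T with
C lower triangular, reduces the last integral to mvGamma, whose finiteness
follows from a recursion on d along the last row and column of X. *)

Require Import Defs.
From HB Require Import structures.
From mathcomp Require Import all_boot all_order all_algebra.
From mathcomp Require Import all_classical all_reals all_analysis.
From mathcomp.real_closed Require mxtens.
From mathcomp Require Import perm measurable_realfun ring lra.

Set Implicit Arguments.
Unset Strict Implicit.
Unset Printing Implicit Defensive.

Import Order.TTheory GRing.Theory Num.Theory.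
Import numFieldNormedType.Exports.

Local Open Scope classical_set_scope.
Local Open Scope ring_scope.

(** * Lebesgue measure on tuples *)

(** Two exponents agree by design. With a = eta d, the measure |X|^(eta-(d+1)/2) dX rescales by (1 +
    t)^-a, with the same a that occurs in s^-a. The t-integral that remains is therefore int t^(a-1)
    (1 + t)^-(a+k) dt = B(a, k). The power 2^-k of the statement arises because the Wishart weight
    is e^(-s/2) and not e^-s. Every change of variables in several dimensions is an affine map with
    lower triangular linear part; such maps reduce by Tonelli to x |-> c x + b on the line. This is
    why Sigma is represented by its Cholesky factor and not by its symmetric square root. The
    identities are proved for nonnegative integrands in the extended reals, so that convergence need
    not be known beforehand. The entries of X^p and of the tensor power may change sign, however.
    They are split into positive and negative parts, which are again homogeneous, and the finiteness
    of Wishart moments allows the two parts to be subtracted. *)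

Section lebesgue_affine.
Context {R : realType}.
Local Open Scope ereal_scope.
Local Notation mu := (@lebesgue_measure R).

Lemma measurable_affine (c b : R) :
  measurable_fun [set: measurableTypeR R]
    ((fun x => c * x + b)%R : measurableTypeR R -> measurableTypeR R).
Proof. by apply: measurable_funD => //; exact: measurable_funM. Qed.

(** Uniqueness of Lebesgue measure: [c] times the image measure gives each interval []x, y]] its
    length. *)
Lemma lebesgue_measure_affine (c b : R) (A : set R) : (0 < c)%R ->
  measurable A ->
  pushforward mu
    ((fun x => c * x + b)%R : measurableTypeR R -> measurableTypeR R) A =
  c^-1%:E * mu A.
Proof.
move=> c0 mA.
have cVge0 : (0 <= c)%R by exact: ltW.
pose k : {nonneg R} := NngNum cVge0.
pose m := measure_function_pushforward__canonical__measure_function_Measure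
  mu (measurable_affine c b).
have := @lebesgue_measure_unique R (mscale k m).
move=> /(_ _ A mA) ->.
  rewrite /mscale /= muleA -EFinM mulVf ?gt_eqF// mul1e//.
move=> _ [[x y] _ <-] /=.
have mE : m `]x, y]%classic = mu `]((x - b) / c)%R, ((y - b) / c)%R]%classic.
  congr (mu _); apply/seteqP; split=> t /=; rewrite !in_itv/= ltr_pdivrMr//;
  by rewrite ler_pdivlMr// ltrBlDr lerBrDr [(t * c)%R]mulrC.
rewrite /mscale /= [X in _ * X]mE.
rewrite !lebesgue_measure_itv/= !lte_fin ltr_pM2r ?invr_gt0// ltrD2r.
case: ifPn => // _; last by rewrite mule0.
by rewrite -!EFinB -EFinM; congr EFin; field; rewrite gt_eqF.
Qed.

Lemma ge0_integral_affine (c b : R) (f : R -> \bar R) : (0 < c)%R ->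
  measurable_fun [set: R] f -> (forall x, 0 <= f x) ->
  \int[mu]_x f (c * x + b)%R = c^-1%:E * \int[mu]_x f x.
Proof.
move=> c0 mf f0.
have cVge0 : (0 <= c^-1)%R by rewrite invr_ge0 ltW.
pose k : {nonneg R} := NngNum cVge0.
have := @ge0_integral_pushforward _ _ _ _ R _
  (measurable_affine c b) mu
  setT f measurableT mf (fun x _ => f0 x).
rewrite preimage_setT /comp => <-.
transitivity (\int[mscale k mu]_x f x); last first.
  by rewrite ge0_integral_mscale.
apply: eq_measure_integral => [|mff A mA _]; first exact: measurable_affine.
by apply: lebesgue_measure_affine.
Qed.

End lebesgue_affine.

Section lebesgue_tuple_integral.
Context {R : realType}.
Local Open Scope ereal_scope.

Lemma measurable_nth_tuple d' (T : measurableType d') n (f : T -> n.-tuple R) i :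
  measurable_fun setT f -> measurable_fun setT (fun x => (f x)`_i : R)%R.
Proof.
move=> mf; case: (ltnP i n) => ni.
  rewrite (_ : (fun _ => _) = fun x => tnth (f x) (Ordinal ni)).
    exact: (measurableT_comp (measurable_tnth _) mf).
  by apply/funext => x; rewrite (tnth_nth 0%R).
rewrite (_ : (fun _ => _) = cst 0%R) //.
by apply/funext => x; rewrite nth_default// size_tuple.
Qed.

Lemma ge0_integral_lebesgue_tuple0 (f : 0.-tuple R -> \bar R) :
  measurable_fun setT f -> (forall t, 0 <= f t) ->
  \int[lebesgue_tuple 0]_t f t = f [tuple].
Proof.
by move=> mf f0; rewrite integral_dirac// diracE in_setT mul1e.
Qed.

Lemma ge0_integral_lebesgue_tupleS n (f : n.+1.-tuple R -> \bar R) :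
  measurable_fun setT f -> (forall t, 0 <= f t) ->
  \int[lebesgue_tuple n.+1]_t f t =
  \int[lebesgue_measure]_x \int[lebesgue_tuple n]_v f [tuple of x :: v].
Proof.
move=> mf f0.
rewrite [LHS](ge0_integral_pushforward (measurable_tuple_cons (n:=n)))//.
rewrite preimage_setT fubini_tonelli1//=.
by apply: (measurableT_comp mf); apply: (measurable_tuple_cons (n:=n)).
Qed.

Lemma measurable_fun_tuple d' (T : measurableType d') n (f : T -> n.-tuple R) :
  (forall i, (i < n)%N -> measurable_fun setT (fun x => (f x)`_i : R)%R) ->
  measurable_fun setT f.
Proof.
move=> mf; apply/measurable_fun_tnthP => i.
rewrite (_ : _ \o _ = fun x => (f x)`_i)%R; first exact: mf.
by apply/funext => x /=; rewrite (tnth_nth 0%R).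
Qed.

Lemma measurable_cat_tuple d' (T : measurableType d') m n
    (f : T -> m.-tuple R) (g : T -> n.-tuple R) :
  measurable_fun setT f -> measurable_fun setT g ->
  measurable_fun setT (fun x => [tuple of f x ++ g x]).
Proof.
move=> mf mg; apply: measurable_fun_tuple => i _ /=.
rewrite (_ : (fun _ => _) =
    fun x => if (i < m)%N then (f x)`_i%R else ((g x)`_(i - m)%N)%R); last first.
  by apply/funext => x; rewrite nth_cat size_tuple.
by case: ltnP => _; exact: measurable_nth_tuple.
Qed.

Lemma measurable_integral_tuple d' (T : measurableType d') n
    (f : T -> n.-tuple R -> \bar R) :
  measurable_fun setT (fun z : T * n.-tuple R => f z.1 z.2) ->
  (forall x v, 0 <= f x v) ->
  measurable_fun setT (fun x => \int[lebesgue_tuple n]_v f x v).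
Proof.
move=> mf f0.
exact: (measurable_fun_fubini_tonelli_F (m2 := lebesgue_tuple n) _ mf
  (fun z => f0 z.1 z.2)).
Qed.

Lemma ge0_integral_lebesgue_tuple_cat m n (f : (m + n).-tuple R -> \bar R) :
  measurable_fun setT f -> (forall t, 0 <= f t) ->
  \int[lebesgue_tuple (m + n)]_t f t =
  \int[lebesgue_tuple m]_u \int[lebesgue_tuple n]_v f [tuple of u ++ v].
Proof.
have mcat k g : measurable_fun setT g -> (forall t, 0 <= g t) ->
    measurable_fun setT (fun u : k.-tuple R =>
      \int[lebesgue_tuple n]_v g [tuple of u ++ v]).
  move=> mg g0; apply: measurable_integral_tuple => //=.
  by apply: measurableT_comp mg _; exact: measurable_cat_tuple.
elim: m f => [|m IH] f mf f0.
  rewrite ge0_integral_lebesgue_tuple0//=.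
  - by apply: eq_integral => v _; congr f; exact/val_inj.
  - exact: mcat.
  - by move=> t; exact: integral_ge0.
rewrite (@ge0_integral_lebesgue_tupleS (m + n))//.
rewrite ge0_integral_lebesgue_tupleS//.
- apply: eq_integral => x _; rewrite IH//.
    by apply: eq_integral => u _; apply: eq_integral => v _; congr f;
      exact/val_inj.
  apply: measurableT_comp mf _.
  exact: measurable_cons.
- exact: mcat.
- by move=> t; exact: integral_ge0.
Qed.

End lebesgue_tuple_integral.

(** * Matrices and triangular affine maps *)

Section measurable_matrix_operations.
Context {d} {T : measurableType d} {R : realType}.
Implicit Types m n p : nat.

Lemma measurable_mx_entry m n (f : T -> 'M[R]_(m, n)) i j :
  measurable_fun setT f -> measurable_fun setT (fun x => f x i j : R).
Proof. by move=> mf; exact: measurableT_comp (measurable_entry i j) mf. Qed.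

Lemma measurable_mulmx m n p (f : T -> 'M[R]_(m, n)) (g : T -> 'M[R]_(n, p)) :
  measurable_fun setT f -> measurable_fun setT g ->
  measurable_fun setT (fun x => f x *m g x).
Proof.
move=> mf mg; apply: measurable_fun_mx => i j.
under eq_fun do rewrite mxE.
by apply: measurable_sum => k; apply: measurable_funM; exact: measurable_mx_entry.
Qed.

Lemma measurable_addmx m n (f g : T -> 'M[R]_(m, n)) :
  measurable_fun setT f -> measurable_fun setT g ->
  measurable_fun setT (fun x => f x + g x).
Proof.
move=> mf mg; apply: measurable_fun_mx => i j.
under eq_fun do rewrite mxE.
by apply: measurable_funD; exact: measurable_mx_entry.
Qed.

Lemma measurable_trmx m n (f : T -> 'M[R]_(m, n)) :
  measurable_fun setT f -> measurable_fun setT (fun x => (f x)^T).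
Proof.
move=> mf; apply: measurable_fun_mx => i j.
by under eq_fun do rewrite mxE; exact: measurable_mx_entry.
Qed.

Lemma measurable_row_mx m n p (f : T -> 'M[R]_(m, n)) (g : T -> 'M[R]_(m, p)) :
  measurable_fun setT f -> measurable_fun setT g ->
  measurable_fun setT (fun x => row_mx (f x) (g x)).
Proof.
move=> mf mg; apply: measurable_fun_mx => i j.
under eq_fun do rewrite mxE.
by case: (fintype.split j) => k; exact: measurable_mx_entry.
Qed.

Lemma measurable_col_mx m n p (f : T -> 'M[R]_(m, p)) (g : T -> 'M[R]_(n, p)) :
  measurable_fun setT f -> measurable_fun setT g ->
  measurable_fun setT (fun x => col_mx (f x) (g x)).
Proof.
move=> mf mg; apply: measurable_fun_mx => i j.
under eq_fun do rewrite mxE.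
by case: (fintype.split i) => k; exact: measurable_mx_entry.
Qed.

Lemma measurable_scalar_mx n (f : T -> R) :
  measurable_fun setT f -> measurable_fun setT (fun x => (f x)%:M : 'M[R]_n).
Proof.
move=> mf; apply: measurable_fun_mx => i j.
under eq_fun do rewrite mxE.
by case: (i == j); [exact: mf|exact: measurable_cst].
Qed.

Lemma measurable_scalemx m n (f : T -> R) (g : T -> 'M[R]_(m, n)) :
  measurable_fun setT f -> measurable_fun setT g ->
  measurable_fun setT (fun x => f x *: g x).
Proof.
move=> mf mg; apply: measurable_fun_mx => i j.
under eq_fun do rewrite mxE.
by apply: measurable_funM => //; exact: measurable_mx_entry.
Qed.

Lemma measurable_submx m n m' n' (f : T -> 'M[R]_(m, n)) (g : 'I_m' -> 'I_m)
    (h : 'I_n' -> 'I_n) :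
  measurable_fun setT f -> measurable_fun setT (fun x => mxsub g h (f x)).
Proof.
move=> mf; apply: measurable_fun_mx => i j.
by under eq_fun do rewrite mxE; exact: measurable_mx_entry.
Qed.

Lemma measurable_mxtrace n (f : T -> 'M[R]_n) :
  measurable_fun setT f -> measurable_fun setT (fun x => \tr (f x)).
Proof.
by move=> mf; apply: measurable_sum => i; exact: measurable_mx_entry.
Qed.

Lemma measurable_det n (f : T -> 'M[R]_n) :
  measurable_fun setT f -> measurable_fun setT (fun x => \det (f x)).
Proof.
move=> mf; apply: measurable_sum => s; apply: measurable_funM => //.
by apply: measurable_prod => i _; exact: measurable_mx_entry.
Qed.

End measurable_matrix_operations.

(** * Lower triangular affine maps on column vectors *)

Section column_vectors.
Context {R : realType}.
Local Open Scope ereal_scope.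

Definition col_of_tuple n (v : n.-tuple R) : 'cV[R]_n := (\col_i v`_i)%R.

Lemma measurable_col_of_tuple n : measurable_fun setT (@col_of_tuple n).
Proof.
apply: measurable_fun_mx => i j; under eq_fun do rewrite mxE.
by apply: measurable_nth_tuple; exact: measurable_id.
Qed.

Lemma measurable_col_scalar n (F : 'cV[R]_(n + 1) -> \bar R) :
  measurable_fun setT F ->
  measurable_fun setT (fun z : 'cV[R]_n * measurableTypeR R =>
    F (col_mx z.1 z.2%:M)).
Proof.
move=> mF; apply: measurableT_comp mF _; apply: measurable_col_mx => //.
exact: measurable_scalar_mx.
Qed.

Lemma measurable_integral_col n (F : 'cV[R]_(n + 1) -> \bar R) :
  measurable_fun setT F -> (forall u, 0 <= F u) ->
  measurable_fun setT (fun u : 'cV[R]_n =>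
    \int[lebesgue_measure]_x F (col_mx u x%:M)).
Proof.
move=> mF F0; exact: (measurable_fun_fubini_tonelli_F (m2 := lebesgue_measure)
  _ (measurable_col_scalar mF) (fun z => F0 _)).
Qed.

(** Tonelli with the last coordinate innermost. Under a lower triangular map only the last entry of
    the image depends on that coordinate, so the inner substitution is one-dimensional. *)
Lemma ge0_integral_col n (F : 'cV[R]_(n + 1) -> \bar R) :
  measurable_fun setT F -> (forall u, 0 <= F u) ->
  \int[lebesgue_tuple (n + 1)]_t F (col_of_tuple t) =
  \int[lebesgue_tuple n]_v \int[lebesgue_measure]_x
    F (col_mx (col_of_tuple v) x%:M).
Proof.
move=> mF F0.
rewrite (ge0_integral_lebesgue_tuple_cat (f := fun t => F (col_of_tuple t)))//;
  last first.
  exact: (measurableT_comp mF (@measurable_col_of_tuple _)).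
apply: eq_integral => u _.
have catE (v : 1.-tuple R) :
    col_of_tuple [tuple of u ++ v] = col_mx (col_of_tuple u) (v`_0)%R%:M.
  apply/matrixP => i j; rewrite !mxE; case: splitP => k ik; rewrite !mxE nth_cat.
    by rewrite size_tuple ik ltn_ord.
  by rewrite size_tuple ik ltnNge leq_addr addKn !ord1.
rewrite (ge0_integral_lebesgue_tupleS
  (f := fun v => F (col_of_tuple [tuple of u ++ v])))//; last first.
  apply: measurableT_comp mF _.
  apply: measurableT_comp (@measurable_col_of_tuple _) _.
  exact: measurable_cat_tuple.
apply: eq_integral => x _.
(* The measure on 0-tuples is a Dirac mass, so the innermost integral is an evaluation. *)
rewrite (_ : (fun v : 0.-tuple R => _) = cst (F (col_mx (col_of_tuple u) x%:M))).
  by rewrite integral_dirac// diracE in_setT mul1e.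
by apply/funext => v; rewrite catE.
Qed.

(** The shape of Cholesky factors. The positive diagonal keeps absolute values out of the
    Jacobians. *)
Definition pos_trig n (L : 'M[R]_n) := is_trig_mx L /\ forall i, (0 < L i i)%R.

Lemma pos_trig_det n (L : 'M[R]_n) : pos_trig L -> (0 < \det L)%R.
Proof. by move=> [/det_trig -> L0]; exact: prodr_gt0. Qed.

Lemma pos_trig_block n (L : 'M[R]_(n + 1)) : pos_trig L ->
  exists L1 l c, [/\ L = (block_mx L1 0 l c%:M)%R, pos_trig L1 & (0 < c)%R].
Proof.
move=> [Lt L0].
exists (ulsubmx L), (dlsubmx L), (L (rshift _ 0%R) (rshift _ 0%R)).
split => //.
  rewrite -{1}[L]submxK; congr block_mx.
    apply/matrixP => i j; rewrite !mxE; move/is_trig_mxP : Lt; apply.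
    by rewrite /= ltn_addr.
  by apply/matrixP => i j; rewrite !mxE !ord1.
split; last by move=> i; rewrite !mxE.
apply/is_trig_mxP => i j ij; rewrite !mxE.
by move/is_trig_mxP : Lt; apply.
Qed.

Lemma block_pos_trig n (L : 'M[R]_n) l c : pos_trig L -> (0 < c)%R ->
  pos_trig (block_mx L 0 l (c%:M : 'M[R]_1))%R.
Proof.
move=> [/is_trig_mxP Lt L0] c0; split.
  apply/is_trig_mxP => i j.
  rewrite -(splitK i) -(splitK j).
  case: (fintype.split i) => i'; case: (fintype.split j) => j' /= ij.
  - by rewrite block_mxEul Lt.
  - by rewrite block_mxEur mxE.
  - by move: ij; rewrite ltnNge ltnW// ltn_addr.
  - by move: ij; rewrite !ord1 ltnn.
move=> i; rewrite -(splitK i); case: (fintype.split i) => k /=.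
  by rewrite block_mxEul.
by rewrite block_mxEdr mxE eqxx.
Qed.

(** Induction on the size: the inner integral over the last coordinate is an affine substitution of
    slope [c], the last diagonal entry, and what remains is the affine map with linear part [L1]. *)
Lemma ge0_integral_col_affine n (L : 'M[R]_n) (b : 'cV[R]_n)
    (F : 'cV[R]_n -> \bar R) : pos_trig L ->
  measurable_fun setT F -> (forall u, 0 <= F u) ->
  \int[lebesgue_tuple n]_v F (L *m col_of_tuple v + b)%R =
  (\det L)^-1%:E * \int[lebesgue_tuple n]_v F (col_of_tuple v).
Proof.
elim: n L b F => [|n IH] L b F.
  move=> _ mF F0; rewrite det_mx00 invr1 mul1e.
  by apply: eq_integral => v _; congr F; rewrite [LHS]flatmx0 [RHS]flatmx0.
(* [n + 1], unlike [n.+1], is the shape on which [block_mx] and [col_mx] act. *)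
move: L b F; rewrite -addn1 => L b F LT mF F0.
have maff : measurable_fun setT (fun u : 'cV[R]_(n + 1) => L *m u + b)%R.
  by apply: measurable_addmx => //; exact: measurable_mulmx.
rewrite (ge0_integral_col (F := fun u => F (L *m u + b)%R))//; last first.
  exact: measurableT_comp mF maff.
rewrite (ge0_integral_col (F := F))//.
have [L1 [l [c [LE L1T c0]]]] := pos_trig_block LT.
rewrite LE det_lblock det_scalar1 -[b]vsubmxK.
pose G u := \int[lebesgue_measure]_x F (col_mx u x%:M).
have mG : measurable_fun setT G by exact: measurable_integral_col.
have G0 u : 0 <= G u by exact: integral_ge0.
transitivity (\int[lebesgue_tuple n]_v
    (c^-1%:E * G (L1 *m col_of_tuple v + usubmx b)%R)).
  apply: eq_integral => v _; rewrite /G.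
  (* The contribution of the other coordinates to the last entry, constant in the inner integral. *)
  pose e := ((l *m col_of_tuple v) 0 0 + b (rshift n 0) 0)%R.
  rewrite -(@ge0_integral_affine _ c e
    (fun x => F (col_mx (L1 *m col_of_tuple v + usubmx b)%R x%:M)))//.
    apply: eq_integral => x _; congr F; rewrite mul_block_col add_col_mx.
    rewrite mul0mx addr0; congr col_mx.
    by apply/matrixP => i j; rewrite !mxE !ord1 big_ord1 !mxE /e /= !mxE; ring.
  exact: (measurableT_comp (measurable_col_scalar mF) (measurable_pair1 _)).
rewrite ge0_integralZl//; last 2 first.
  apply: measurableT_comp mG _; apply: measurable_addmx => //.
  by apply: measurable_mulmx => //; exact: measurable_col_of_tuple.
  by rewrite lee_fin invr_ge0 ltW.
by rewrite IH// muleA -EFinM invfM mulrC.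
Qed.

End column_vectors.

(** * Lebesgue measure on symmetric matrices *)

Section symmetric_integral.
Context {R : realType}.
Local Open Scope ereal_scope.

Lemma ge0_integral_sym n (F : 'M[R]_n -> \bar R) :
  measurable_fun setT F -> (forall X, 0 <= F X) ->
  \int[lebesgue_sym n]_X F X =
  \int[lebesgue_tuple (n * n.+1)./2]_u F (sym_of_tuple u).
Proof.
move=> mF F0.
by rewrite [LHS](ge0_integral_pushforward (@measurable_sym_of_tuple R n)).
Qed.

Lemma trmx_sym_of_tuple n (u : (n * n.+1)./2.-tuple R) :
  (sym_of_tuple u)^T%R = sym_of_tuple u.
Proof. by apply/matrixP => i j; rewrite !mxE maxnC minnC. Qed.

(** The column [c] carries all [n + 1] new coordinates of a symmetric matrix with leading block [Y],
    corner last; the last row is forced by symmetry. *)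
Definition bordered n (Y : 'M[R]_n) (c : 'cV[R]_(n + 1)) : 'M[R]_(n + 1) :=
  block_mx Y (usubmx c) (usubmx c)^T (dsubmx c).

Lemma measurable_bordered d' (T : measurableType d') n (f : T -> 'M[R]_n)
    (g : T -> 'cV[R]_(n + 1)) :
  measurable_fun setT f -> measurable_fun setT g ->
  measurable_fun setT (fun x => bordered (f x) (g x)).
Proof.
move=> mf mg.
have mu : measurable_fun setT (fun x => usubmx (g x)).
  by under eq_fun do rewrite usubmxEsub; exact: measurable_submx.
have md : measurable_fun setT (fun x => dsubmx (g x)).
  by under eq_fun do rewrite dsubmxEsub; exact: measurable_submx.
apply: measurable_col_mx; apply: measurable_row_mx => //.
exact: measurable_trmx.
Qed.

Lemma measurable_integral_bordered n (F : 'M[R]_(n + 1) -> \bar R) :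
  measurable_fun setT F -> (forall X, 0 <= F X) ->
  measurable_fun setT (fun Y : 'M[R]_n =>
    \int[lebesgue_tuple (n + 1)]_w F (bordered Y (col_of_tuple w))).
Proof.
move=> mF F0; apply: measurable_integral_tuple => //=.
apply: measurableT_comp mF _; apply: measurable_bordered => //.
exact: measurableT_comp (@measurable_col_of_tuple _ _) _.
Qed.

(** Entry (i, j), i <= j, is coordinate j(j+1)/2 + i. Hence the first n(n+1)/2 coordinates fill the
    leading block, and the last n + 1 fill the bordering column from top to bottom. *)
Lemma ge0_integral_sym_bordered n (F : 'M[R]_(n + 1) -> \bar R) :
  measurable_fun setT F -> (forall X, 0 <= F X) ->
  \int[lebesgue_sym (n + 1)]_X F X =
  \int[lebesgue_tuple (n * n.+1)./2]_u \int[lebesgue_tuple (n + 1)]_w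
    F (bordered (sym_of_tuple u) (col_of_tuple w)).
Proof.
move=> mF F0; rewrite ge0_integral_sym//.
(* On sequences instead of tuples: the two expressions for the number of coordinates are equal but
   not convertible, so the length [N] is made a variable and the equation is substituted for it. *)
pose S (s : seq R) : 'M[R]_(n + 1) := (\matrix_(i, j)
  s`_((maxn i j * (maxn i j).+1)./2 + minn i j)%N)%R.
have SE N : N = ((n * n.+1)./2 + (n + 1))%N ->
    \int[lebesgue_tuple N]_v F (S v) =
    \int[lebesgue_tuple (n * n.+1)./2]_u \int[lebesgue_tuple (n + 1)]_w
      F (bordered (sym_of_tuple u) (col_of_tuple w)).
  move=> ->; rewrite (ge0_integral_lebesgue_tuple_cat (f := fun v => F (S v)))//;
    last first.
    apply: measurableT_comp mF _; apply: measurable_fun_mx => i j.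
    under eq_fun do rewrite mxE.
    by apply: measurable_nth_tuple; exact: measurable_id.
  apply: eq_integral => u _; apply: eq_integral => w _; congr F.
  apply/matrixP => i j; rewrite -(splitK i) -(splitK j).
  case: (fintype.split i) => i'; case: (fintype.split j) => j'.
  - rewrite block_mxEul !mxE/= nth_cat size_tuple.
    by rewrite (sym_of_tuple_index i' j').
  - rewrite block_mxEur !mxE/= !ord1 addn0 nth_cat size_tuple.
    rewrite (maxn_idPr (ltnW (ltn_ord i'))) (minn_idPl (ltnW (ltn_ord i'))).
    by rewrite ltnNge leq_addr addKn.
  - rewrite block_mxEdl !mxE/= !ord1 addn0 nth_cat size_tuple.
    rewrite (maxn_idPl (ltnW (ltn_ord j'))) (minn_idPr (ltnW (ltn_ord j'))).
    by rewrite ltnNge leq_addr addKn.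
  - rewrite block_mxEdr !mxE/= !ord1 addn0 nth_cat size_tuple maxnn minnn.
    by rewrite ltnNge leq_addr addKn.
apply: SE; rewrite addn1 (_ : n.+1 * n.+2 = n * n.+1 + n.+1.*2)%N.
  by rewrite halfD odd_double andbF add0n doubleK.
by rewrite -mul2n -mulnDl addn2 mulnC.
Qed.

(** For [c] made of a column v over a corner x, the new corner is l Y l^T + 2 k l v + k^2 x. By
    symmetry v enters it twice, whence the factor [2 * k]. The new leading block does not involve
    [c]. *)
Lemma congr_bordered n (L Y : 'M[R]_n) (l : 'rV[R]_n) (k : R)
    (c : 'cV[R]_(n + 1)) : (Y^T = Y)%R ->
  (block_mx L 0 l (k%:M : 'M[R]_1) *m bordered Y c *m
    (block_mx L 0 l (k%:M : 'M[R]_1))^T =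
  bordered (L *m Y *m L^T)
    (block_mx (k *: L) 0 ((2 * k) *: l) ((k ^+ 2)%:M : 'M[R]_1) *m c +
     col_mx (L *m Y *m l^T) (l *m Y *m l^T)))%R.
Proof.
move=> Ys; rewrite /bordered.
have -> : (block_mx (k *: L) 0 ((2 * k) *: l) ((k ^+ 2)%:M : 'M[R]_1) *m c =
    col_mx (k *: L *m usubmx c)
      ((2 * k) *: l *m usubmx c + (k ^+ 2)%:M *m dsubmx c))%R.
  by rewrite -{1}[c]vsubmxK mul_block_col mul0mx addr0.
rewrite add_col_mx.
rewrite tr_block_mx mulmx_block mulmx_block.
rewrite !(col_mxKu, col_mxKd) !(mul0mx, mulmx0, trmx0, add0r, addr0).
rewrite !tr_scalar_mx !(mul_scalar_mx, mul_mx_scalar).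
congr block_mx.
- by rewrite addrC -scalemxAl.
- rewrite linearD/= !trmx_mul trmxK Ys mulmxDl mulmxA addrC.
  by rewrite [((k *: L)^T)%R]linearZ/= -scalemxAl -scalemxAr.
rewrite mulmxDl scalerDr -!scalemxAl scalerA -expr2.
rewrite (_ : (usubmx c)^T *m l^T = l *m usubmx c)%R; last first.
  rewrite -trmx_mul; apply/matrixP => i j; rewrite !ord1.
  by rewrite [LHS]mxE.
rewrite -[((2 * k) *: _)%R]scalerA scaler_nat mulr2n.
by rewrite -!addrA [LHS]addrC -!addrA.
Qed.

(* The Jacobian of X |-> C X C^T is det C ^ (n + 1): bordering X by one column
   turns the congruence into an affine map of that column, whose linear part is
   again lower triangular. *)
Lemma ge0_integral_sym_congr n (C : 'M[R]_n) (F : 'M[R]_n -> \bar R) :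
  pos_trig C -> measurable_fun setT F -> (forall X, 0 <= F X) ->
  \int[lebesgue_sym n]_X F (C *m X *m C^T)%R =
  ((\det C ^+ n.+1)^-1)%:E * \int[lebesgue_sym n]_X F X.
Proof.
elim: n C F => [|n IH] C F.
  move=> _ mF F0; rewrite det_mx00 expr1n invr1 mul1e.
  by apply: eq_integral => v _; congr F; rewrite [LHS]flatmx0 [RHS]flatmx0.
rewrite -[X in (\det C ^+ X.+1)%R]addn1.
move: C F; rewrite -addn1 => C F CT mF F0.
have mcongr m (D : 'M[R]_m) :
    measurable_fun setT (fun X : 'M[R]_m => D *m X *m D^T)%R.
  by apply: measurable_mulmx => //; exact: measurable_mulmx.
rewrite (ge0_integral_sym_bordered (F := fun X => F (C *m X *m C^T)%R))//;
  last exact: measurableT_comp mF (mcongr _ _).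
rewrite ge0_integral_sym_bordered//.
have [L [l [k [CE LT k0]]]] := pos_trig_block CT.
pose M : 'M[R]_(n + 1) := (block_mx (k *: L) 0 ((2 * k) *: l) (k ^+ 2)%:M)%R.
(* The bordering column contributes k^(n+2) det L and the leading block, by induction, (det
   L)^(n+1); since det C = k det L, the product is (det C)^(n+2). *)
have detM : (\det M = k ^+ n.+2 * \det L)%R.
  by rewrite /M det_lblock detZ det_scalar1 !exprS; ring.
have MT : pos_trig M.
  apply: block_pos_trig; last exact: exprn_gt0.
  case: LT => /is_trig_mxP Lt L0; split; last by move=> i; rewrite mxE mulr_gt0.
  by apply/is_trig_mxP => i j ij; rewrite mxE Lt// mulr0.
pose H Y := \int[lebesgue_tuple (n + 1)]_w F (bordered Y (col_of_tuple w)).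
have mH : measurable_fun setT H by exact: measurable_integral_bordered.
have H0 Y : 0 <= H Y by exact: integral_ge0.
transitivity (\int[lebesgue_tuple (n * n.+1)./2]_u
    (((\det M)^-1)%:E * H (L *m sym_of_tuple u *m L^T)%R)).
  apply: eq_integral => u _.
  pose b := (col_mx (L *m sym_of_tuple u *m l^T) (l *m sym_of_tuple u *m l^T))%R.
  rewrite [LHS](eq_integral (fun w : (n + 1).-tuple R =>
    F (bordered (L *m sym_of_tuple u *m L^T)%R (M *m col_of_tuple w + b)%R)));
    last by move=> w _; rewrite CE congr_bordered// trmx_sym_of_tuple.
  rewrite (@ge0_integral_col_affine _ _ M b
    (fun c => F (bordered (L *m sym_of_tuple u *m L^T)%R c)))//.
  apply: measurableT_comp mF _; apply: measurable_bordered.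
    exact: measurable_cst.
  exact: measurable_id.
have mHL : measurable_fun setT (fun X => H (L *m X *m L^T)%R).
  exact: measurableT_comp mH (mcongr _ _).
have mHLs := measurableT_comp mHL (@measurable_sym_of_tuple R n).
have detV0 : 0 <= ((\det M)^-1)%:E by rewrite lee_fin invr_ge0 ltW// pos_trig_det.
rewrite (ge0_integralZl _ measurableT mHLs (fun u _ => H0 _) detV0).
rewrite -(ge0_integral_sym (F := fun X => H (L *m X *m L^T)%R))//.
rewrite IH// (ge0_integral_sym mH H0) muleA -EFinM detM CE det_lblock det_scalar1.
congr (_%:E * _); rewrite -invfM; congr (_^-1)%R.
by rewrite addn1 exprMn !exprS; ring.
Qed.

End symmetric_integral.

(** * Positive definite matrices *)

Section positive_definite.
Context {R : realType}.
Implicit Types n : nat.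

Lemma pos_trig_unit n (L : 'M[R]_n) : pos_trig L -> L \in unitmx.
Proof. by move=> LT; rewrite unitmxE unitfE gt_eqF// pos_trig_det. Qed.

Lemma pos_trig_scalar n (c : R) : 0 < c -> pos_trig (c%:M : 'M[R]_n).
Proof.
move=> c0; split; first exact: scalar_mx_is_trig.
by move=> i; rewrite mxE eqxx.
Qed.

Lemma posdef_congr n (C X : 'M[R]_n) : C \in unitmx -> posdef n X ->
  posdef n (C *m X *m C^T).
Proof.
move=> Cu [Xs X0]; split; first by rewrite !trmx_mul trmxK Xs mulmxA.
move=> v v0; have := X0 (C^T *m v).
rewrite trmx_mul trmxK !mulmxA; apply; apply: contraNneq v0 => Cv0.
by rewrite -[v](@mulKmx _ _ _ C^T) ?unitmx_tr// Cv0 mulmx0.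
Qed.

Lemma posdef_congrE n (C X : 'M[R]_n) : C \in unitmx ->
  posdef n (C *m X *m C^T) <-> posdef n X.
Proof.
move=> Cu; split; last exact: posdef_congr.
move=> /(@posdef_congr _ (invmx C)); rewrite unitmx_inv => /(_ Cu).
by rewrite !mulmxA mulVmx// mul1mx -mulmxA -trmx_mul mulVmx// trmx1 mulmx1.
Qed.

Lemma mulmx_trl n (v : 'cV[R]_n) : (v^T *m v) 0 0 = \sum_i v i 0 ^+ 2.
Proof. by rewrite mxE; apply: eq_bigr => i _; rewrite mxE expr2. Qed.

Lemma posdef1 n : posdef n (1%:M : 'M[R]_n).
Proof.
split=> [|v v0]; first exact: trmx1.
rewrite mulmx1 mulmx_trl lt_neqAle sumr_ge0 ?andbT => [|i _]; last exact: sqr_ge0.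
apply: contraNneq v0 => /esym/eqP.
rewrite psumr_eq0 => [|i _]; last exact: sqr_ge0.
move=> /allP v0; apply/eqP/matrixP => i j; rewrite !ord1 mxE.
by have := v0 i; rewrite mem_index_enum sqrf_eq0 => /(_ isT)/eqP.
Qed.

Lemma posdef_mul_tr n (L : 'M[R]_n) : L \in unitmx -> posdef n (L *m L^T).
Proof. by move=> /posdef_congr /(_ (posdef1 n)); rewrite mulmx1. Qed.

Lemma posdef_bordered n (Y : 'M[R]_n) c :
  posdef (n + 1) (bordered Y c) -> posdef n Y.
Proof.
rewrite /bordered => -[Xs X0]; split.
  by move: Xs; rewrite tr_block_mx => /eq_block_mx[].
move=> v v0; have := X0 (col_mx v 0).
rewrite tr_col_mx trmx0 mul_row_block mul_row_col !mul0mx !mulmx0 !addr0.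
by apply; apply: contraNneq v0; rewrite -[0 in RHS]col_mx0 => /eq_col_mx[->].
Qed.

Lemma posdef_block1 n (z : R) :
  posdef (n + 1) (bordered 1%:M (col_mx 0 z%:M)) <-> 0 < z.
Proof.
rewrite /bordered col_mxKu col_mxKd trmx0; split=> [[_ X0]|z0].
  have := X0 (col_mx 0 1%:M).
  rewrite tr_col_mx trmx0 mul_row_block mul_row_col !(mul0mx, mulmx0, add0r).
  rewrite trmx1 mulmx1 mul1mx mxE eqxx; apply.
  rewrite -[X in _ != X]col_mx0; apply/eqP => /eq_col_mx[_] /matrixP/(_ 0 0)/eqP.
  by rewrite !mxE oner_eq0.
have -> : block_mx (1%:M : 'M[R]_n) 0 0 (z%:M : 'M[R]_1) =
    (block_mx 1%:M 0 0 (Num.sqrt z)%:M) *m (block_mx 1%:M 0 0 (Num.sqrt z)%:M)^T.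
  rewrite tr_block_mx mulmx_block !(trmx0, mulmx0, mul0mx, add0r, addr0) trmx1.
  by rewrite mulmx1 tr_scalar_mx -scalar_mxM -expr2 sqr_sqrtr ?ltW.
apply/posdef_mul_tr/pos_trig_unit/block_pos_trig; last by rewrite sqrtr_gt0.
exact/pos_trig_scalar/ltr01.
Qed.

(** Gaussian elimination of the last row and column. If the leading block is L L^T and the last
    column is L u, then [z] is the Schur complement of that block. *)
Lemma bordered_congr n (L : 'M[R]_n) (u : 'cV[R]_n) (z : R) :
  bordered (L *m L^T) (col_mx (L *m u) (z + (u^T *m u) 0 0)%:M) =
  block_mx L 0 u^T (1%:M : 'M[R]_1) *m bordered 1%:M (col_mx 0 z%:M) *m
    (block_mx L 0 u^T (1%:M : 'M[R]_1))^T.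
Proof.
rewrite congr_bordered ?trmx1//; congr bordered; first by rewrite mulmx1.
rewrite mul_block_col add_col_mx !(mulmx0, mul0mx, mulmx1) trmxK add0r.
congr col_mx; first by rewrite add0r.
by rewrite add0r expr1n mul1mx; apply/matrixP => i j; rewrite !ord1 !mxE.
Qed.

Lemma posdef_bordered_chol n (L : 'M[R]_n) (u : 'cV[R]_n) (z : R) :
  pos_trig L ->
  posdef (n + 1)
    (bordered (L *m L^T) (col_mx (L *m u) (z + (u^T *m u) 0 0)%:M)) <-> 0 < z.
Proof.
move=> LT; rewrite bordered_congr posdef_congrE; first exact: posdef_block1.
exact/pos_trig_unit/block_pos_trig.
Qed.

Lemma det_bordered_chol n (L : 'M[R]_n) (u : 'cV[R]_n) (z : R) :
  \det (bordered (L *m L^T) (col_mx (L *m u) (z + (u^T *m u) 0 0)%:M)) =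
  \det L ^+ 2 * z.
Proof.
rewrite bordered_congr !det_mulmx det_tr /bordered col_mxKu col_mxKd trmx0.
by rewrite !det_lblock !det_scalar1 det1; ring.
Qed.

Lemma bordered_submx n (X : 'M[R]_(n + 1)) : X^T = X ->
  X = bordered (ulsubmx X) (col_mx (ursubmx X) (drsubmx X)).
Proof.
move=> Xs; rewrite /bordered col_mxKu col_mxKd.
by rewrite trmx_ursub Xs submxK.
Qed.

(** The factor of the leading block is extended by one row: its last diagonal entry is the square
    root of the Schur complement, which is positive by [posdef_bordered_chol]. *)
Lemma cholesky n (X : 'M[R]_n) : posdef n X ->
  exists2 L, pos_trig L & X = L *m L^T.
Proof.
elim: n X => [|n IH] X.
  move=> _; exists 0; last by rewrite [LHS]flatmx0 [RHS]flatmx0.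
  by split; [apply/is_trig_mxP|]; case.
move: X; rewrite -addn1 => X Xp; have [Xs _] := Xp.
move: Xp; rewrite (bordered_submx Xs).
move: (ulsubmx X) (ursubmx X) (drsubmx X) => Y v x Xp.
have [L LT YE] := IH _ (posdef_bordered Xp).
have Lu := pos_trig_unit LT.
(* These choices put an arbitrary column [v] and corner [x] in the form L u and z + u^T u. *)
pose u := invmx L *m v; pose z := x 0 0 - (u^T *m u) 0 0.
have vE : v = L *m u by rewrite /u mulKVmx.
have xE : x = (z + (u^T *m u) 0 0)%:M.
  by apply/matrixP => i j; rewrite !ord1 mxE eqxx mulr1n /z subrK.
have z0 : 0 < z by move: Xp; rewrite YE vE xE posdef_bordered_chol.
exists (block_mx L 0 u^T (Num.sqrt z)%:M).
  by apply: block_pos_trig; rewrite ?sqrtr_gt0.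
rewrite YE vE xE /bordered col_mxKu col_mxKd tr_block_mx mulmx_block.
rewrite !(trmx0, mulmx0, mul0mx, addr0, trmxK) trmx_mul; congr block_mx.
apply/matrixP => i j; rewrite !ord1 tr_scalar_mx -scalar_mxM -expr2.
by rewrite sqr_sqrtr ?ltW// !mxE eqxx !mulr1n addrC.
Qed.

Lemma posdef_det_gt0 n (X : 'M[R]_n) : posdef n X -> 0 < \det X.
Proof.
move=> /cholesky[L LT ->]; rewrite det_mulmx det_tr.
by rewrite mulr_gt0// pos_trig_det.
Qed.

Lemma posdef_trace_gt0 n (X : 'M[R]_n.+1) : posdef n.+1 X -> 0 < \tr X.
Proof.
move=> [_ X0]; have Xii i : 0 < X i i.
  have := X0 (delta_mx i 0); rewrite trmx_delta -rowE -colE !mxE; apply.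
  by apply/eqP => /matrixP/(_ i 0)/eqP; rewrite !mxE !eqxx oner_eq0.
rewrite /mxtrace (bigD1 ord0)//= ltr_pwDl// sumr_ge0// => i _; exact: ltW.
Qed.

(** With leading block L L^T the determinant is (det L)^2 z, so it has the sign of the Schur
    complement z. The criterion replaces a condition on all vectors by finitely many polynomial
    ones, which makes the cone measurable. *)
Lemma sylvester n (X : 'M[R]_(n + 1)) : posdef (n + 1) X <->
  [/\ X^T = X, posdef n (ulsubmx X) & 0 < \det X].
Proof.
split=> [Xp|[Xs]].
  have [Xs _] := Xp; split=> //; last exact: posdef_det_gt0.
  by move: Xp; rewrite {1}(bordered_submx Xs); exact: posdef_bordered.
rewrite [X in 0 < \det X]bordered_submx// [X in posdef (n + 1) X]bordered_submx//.
move: (ulsubmx X) (ursubmx X) (drsubmx X) => Y v x /cholesky[L LT ->].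
pose u := invmx L *m v; pose z := x 0 0 - (u^T *m u) 0 0.
have -> : v = L *m u by rewrite /u mulKVmx// pos_trig_unit.
have -> : x = (z + (u^T *m u) 0 0)%:M.
  by apply/matrixP => i j; rewrite !ord1 mxE eqxx mulr1n /z subrK.
rewrite det_bordered_chol posdef_bordered_chol//.
by rewrite pmulr_rgt0// exprn_gt0// pos_trig_det.
Qed.

Lemma measurable_posdef n : measurable (posdef n : set 'M[R]_n).
Proof.
elim: n => [|n IH].
  rewrite (_ : posdef 0 = setT)//; apply/seteqP; split=> // X _.
  by split=> [|v]; [rewrite [LHS]flatmx0 [RHS]flatmx0|rewrite flatmx0 eqxx].
rewrite -addn1.
(* Symmetry as a single equation: this sum of squares vanishes exactly on symmetric matrices. *)
pose asym (X : 'M[R]_(n + 1)) := \sum_i \sum_j (X i j - X j i) ^+ 2.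
rewrite (_ : posdef (n + 1) = (asym @^-1` [set 0]) `&`
    (ulsubmx @^-1` posdef n) `&` (determinant @^-1` `]0, +oo[)); last first.
  apply/seteqP; split=> X /=.
    move=> /sylvester[Xs Xu X0]; rewrite in_itv/= X0; split=> //; split=> //.
    rewrite /asym big1// => i _; rewrite big1// => j _.
    by rewrite -{1}Xs mxE subrr expr0n.
  rewrite in_itv/= andbT => -[[asX Xu] X0]; apply/sylvester; split=> //.
  apply/matrixP => i j; rewrite mxE.
  move/eqP: asX; rewrite psumr_eq0 => [/allP/(_ j)|k _]; last first.
    by apply: sumr_ge0 => l _; exact: sqr_ge0.
  rewrite mem_index_enum => /(_ isT); rewrite psumr_eq0 => [/allP/(_ i)|k _];
    last exact: sqr_ge0.
  by rewrite mem_index_enum sqrf_eq0 subr_eq0 => /(_ isT)/eqP.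
have masym : measurable_fun setT asym.
  apply: measurable_sum => i; apply: measurable_sum => j.
  apply: measurable_funX; apply: measurable_funB; exact: measurable_entry.
have mul : measurable_fun setT (@ulsubmx R n 1 n 1).
  rewrite (_ : ulsubmx = mxsub (lshift 1) (lshift 1)).
    exact: (measurable_submx _ _ (@measurable_id _ _ _)).
  by apply/funext => X; exact: ulsubmxEsub.
have mdet := @measurable_det _ _ R (n + 1) id (@measurable_id _ _ _).
apply: measurableI; [apply: measurableI|].
- by rewrite -[X in measurable X]setTI; exact: masym.
- by rewrite -[X in measurable X]setTI; exact: mul.
- by rewrite -[X in measurable X]setTI; exact: mdet.
Qed.

End positive_definite.

(** * Gamma and Beta functions *)

Section gamma_function.
Context {R : realType}.
Implicit Types a s x t : R.
Local Open Scope ereal_scope.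
Local Notation mu := (@lebesgue_measure R).

(** Gamma integrand of rate [s]. The indicator extends it by zero to the whole line, so that Tonelli
    and affine substitutions apply without a domain. *)
Definition gamma_kernel a s t : R :=
  (\1_`]0, +oo[ t * (t `^ (a - 1) * expR (- (t * s))))%R.

Lemma gamma_kernel_ge0 a s t : (0 <= gamma_kernel a s t)%R.
Proof. by rewrite !mulr_ge0// ?powR_ge0 ?expR_ge0// indicE ler0n. Qed.

Lemma measurable_gamma_kernel d (T : measurableType d) (f g : T -> R) a :
  measurable_fun setT f -> measurable_fun setT g ->
  measurable_fun setT (fun z => gamma_kernel a (f z) (g z)).
Proof.
move=> mf mg; apply: measurable_funM.
  have mI : measurable_fun setT (\1_`]0%R, +oo[ : R -> R).
    by apply: measurable_indic; exact: measurable_itv.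
  exact: (measurableT_comp mI mg).
apply: measurable_funM.
  exact: (measurableT_comp (measurable_powR _) mg).
apply: measurableT_comp => //; apply: measurableT_comp => //.
exact: measurable_funM.
Qed.

Lemma measurable_gamma_kernelr a s :
  measurable_fun [set: R] (gamma_kernel a s).
Proof. exact: (@measurable_gamma_kernel _ R (cst s) id). Qed.

Lemma ge0_integral_indic_itvoy (f : R -> R) :
  \int[mu]_(x in `]0%R, +oo[) (f x)%:E =
  \int[mu]_x (\1_`]0%R, +oo[ x * f x)%:E.
Proof.
rewrite integral_mkcond; apply: eq_integral => x _.
by rewrite patchE indicE; case: ifP => _; rewrite ?mul1r ?mul0r.
Qed.

Lemma ge0_integral_lebesgueZl (c : R) (f : R -> \bar R) : (0 <= c)%R ->
  measurable_fun [set: R] f -> (forall x, 0 <= f x) ->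
  \int[mu]_x (c%:E * f x) = c%:E * \int[mu]_x f x.
Proof. by move=> c0 mf f0; rewrite ge0_integralZl_EFin. Qed.

(** For a < 1 the integrand is unbounded at 0. The interval is exhausted by compact ones, where the
    antiderivative t^a / a applies, and monotone convergence gives the limit. *)
Lemma integral_powR_le1 a : (0 < a)%R ->
  \int[mu]_(x in `]0%R, 1%R]) (x `^ (a - 1))%:E <= (a^-1)%:E.
Proof.
move=> a0; have aV0 : (0 <= a^-1)%R by rewrite invr_ge0 ltW.
(* [i.+2] keeps the left endpoint strictly below 1, so that no interval is degenerate. *)
pose F (i : nat) := `[(i.+2%:R^-1)%R : R, 1%R]%classic.
have FE : \bigcup_i F i = `]0%R, 1%R]%classic.
  apply/seteqP; split=> [x [i _]|x].
    rewrite /F /= !in_itv/= => /andP[ix ->]; rewrite andbT.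
    by rewrite (lt_le_trans _ ix)// invr_gt0 ltr0n.
  rewrite /= in_itv/= => /andP[x0 x1].
  have [i ix] : exists i, (x^-1 <= i.+2%:R)%R.
    exists (Num.bound x^-1); rewrite (le_trans (ltW (archi_boundP _)))//.
      by rewrite invr_ge0 ltW.
    by rewrite ler_nat -addn2 leq_addr.
  exists i => //; rewrite /F /= in_itv/= x1 andbT.
  by rewrite -[leRHS]invrK lef_pV2// ?posrE ?invr_gt0// ltr0n.
rewrite -FE.
have mpow : measurable_fun setT (fun x => (x `^ (a - 1))%:E).
  by apply/measurable_EFinP; exact: measurable_powR.
have ndF : nondecreasing_seq F.
  move=> i j ij; apply/subsetPset => x; rewrite /F /= !in_itv/= => /andP[ix ->].
  by rewrite andbT (le_trans _ ix)// lef_pV2 ?posrE ?ltr0n// ler_nat !ltnS.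
have mF i : (measurable (F i : set (measurableTypeR R))) by exact: measurable_itv.
have pow0 i x : F i x -> 0 <= (x `^ (a - 1))%:E by rewrite lee_fin powR_ge0.
have mpF i : measurable_fun (F i : set (measurableTypeR R))
    (fun x => (x `^ (a - 1))%:E).
  exact: measurable_funTS.
have /cvg_lim <- // :=
  ge0_nondecreasing_set_cvg_integral (mu := mu) ndF mF mpF pow0.
apply: lime_le.
  apply: ereal_nondecreasing_is_cvgn.
  exact: ge0_nondecreasing_set_nondecreasing_integral.
apply: nearW => i; rewrite /F.
have e0 : (0 < i.+2%:R^-1 :> R)%R by rewrite invr_gt0 ltr0n.
have e1 : (i.+2%:R^-1 < 1 :> R)%R by rewrite invf_lt1 ?ltr0n// ltr1n.
move: (_^-1)%R e0 e1 => e e0 e1.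
have dpow b x : (0 < x)%R -> derivable (fun y : R => y `^ b)%R x 1.
  by move=> x0; apply: derivable_powR; rewrite in_itv/= x0.
have cpow b x : (0 < x)%R -> {for x, continuous (fun y : R => y `^ b)%R}.
  by move=> x0; apply/differentiable_continuous/derivable1_diffP/dpow.
rewrite (@continuous_FTC2 _ _ (fun x => a^-1 * x `^ a)%R)//.
- by rewrite powR1 mulr1 lee_fin lerBlDl lerDr mulr_ge0// powR_ge0.
- apply: derivable_within_continuous => x; rewrite in_itv/= => /andP[ex _].
  by apply: dpow; rewrite (lt_le_trans e0).
- split.
  + move=> x; rewrite in_itv/= => /andP[ex _].
    by apply: derivableM => //; apply: dpow; rewrite (lt_trans e0).
  + by apply/cvg_at_right_filter; apply: cvgM; [exact: cvg_cst|exact: cpow].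
  + by apply/cvg_at_left_filter; apply: cvgM; [exact: cvg_cst|exact: cpow].
- move=> x; rewrite in_itv/= => /andP[ex _]; have x0 := lt_trans e0 ex.
  rewrite derive1Ml; last exact: dpow.
  by rewrite powR_derive1 ?in_itv/= ?x0// mulrA mulVf ?gt_eqF// mul1r.
Qed.

(** On ]0, 1] the exponential is at most 1, and [integral_powR_le1] applies. Beyond 1 the power is
    at most a multiple of e^(t/2), which leaves an exponential density of rate 1/2. *)
Lemma integral_gamma_kernel_lty a : (0 < a)%R ->
  \int[mu]_t (gamma_kernel a 1 t)%:E < +oo.
Proof.
move=> a0.
(* The factor n! 2^n comes from (t/2)^n / n! <= e^(t/2); the last 2 cancels the rate in front of the
   exponential density. *)
pose n := Num.bound a; pose C : R := (n`!%:R * 2 ^+ n * 2)%R.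
have C0 : (0 <= C)%R by rewrite !mulr_ge0// ?ler0n// exprn_ge0.
pose f t : R := (\1_`]0, 1] t * t `^ (a - 1))%R.
pose e t : R := (C * exponential_pdf 2^-1 t)%R.
have f0 t : (0 <= f t)%R by rewrite mulr_ge0 ?powR_ge0// indicE ler0n.
have half0 : (0 < 2^-1 :> R)%R by rewrite invr_gt0.
have pdf0 t : (0 <= exponential_pdf 2^-1 t :> R)%R.
  exact/exponential_pdf_ge0/ltW.
have e0 t : (0 <= e t)%R by rewrite mulr_ge0.
have mf : measurable_fun setT f.
  by apply: measurable_funM; [exact: measurable_indic|exact: measurable_powR].
have me : measurable_fun setT e.
  by apply: measurable_funM => //; exact: measurable_exponential_pdf.
have mfE : measurable_fun setT (EFin \o f) by exact/measurable_EFinP.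
have meE : measurable_fun setT (EFin \o e) by exact/measurable_EFinP.
have mk := measurable_gamma_kernelr a 1.
apply: (@le_lt_trans _ _ (\int[mu]_t ((f t)%:E + (e t)%:E))).
  apply: ge0_le_integral => //=.
  - by move=> t _; rewrite lee_fin gamma_kernel_ge0.
  - exact/measurable_EFinP.
  - exact: emeasurable_funD.
  move=> t _; rewrite -EFinD lee_fin /gamma_kernel /f !indicE !mem_setE !in_itv/=.
  rewrite andbT mulr1.
  have [t0|t0] := ltP 0%R t; last by rewrite !mul0r add0r.
  have [t1|t1] := leP t 1%R; rewrite ?mul1r ?mul0r ?add0r.
    rewrite -[leLHS]addr0 lerD// ler_piMr ?powR_ge0//.
    by rewrite -expR0 ler_expR lerNl oppr0 ltW.
  rewrite /e exponential_pdfE ?(ltW t0)///=.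
  have tn : (t `^ (a - 1) <= t ^+ n)%R.
    rewrite -powR_mulrn ?(ltW t0)// ler_powR ?(ltW t1)//.
    by rewrite lerBlDr ltW// (lt_trans (archi_boundP (ltW a0)))// ltrDl.
  have tE : (t ^+ n <= n`!%:R * 2 ^+ n * expR (t / 2))%R.
    case: (n) => [|m].
      by rewrite !expr0 fact0 !mul1r -expR0 ler_expR divr_ge0// ltW.
    have /(expR_ge1Dxn m) :=
      (divr_ge0 (ltW t0) (ltW (ltr0Sn R 1)) : 0 <= t / 2)%R.
    move=> /(le_trans _) h.
    have : ((t / 2) ^+ m.+1 / (m.+1)`!%:R <= expR (t / 2))%R.
      by apply: h; rewrite lerDr.
    rewrite ler_pdivrMr ?ltr0n ?fact_gt0// expr_div_n ler_pdivrMr ?exprn_gt0//.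
    by move=> h2; rewrite (le_trans h2)// [leRHS]mulrC mulrA.
  have -> : (C * (2^-1 * expR (- 2^-1 * t)) =
      n`!%:R * 2 ^+ n * expR (t / 2) * expR (- t))%R.
    rewrite /C -!mulrA -expRD; congr (_ * (_ * _))%R.
    by rewrite mulrA divff// mul1r; congr expR; field.
  by rewrite ler_pM2r ?expR_gt0// (le_trans tn).
rewrite ge0_integralD//=; last 2 first.
- by move=> t _; rewrite lee_fin.
- by move=> t _; rewrite lee_fin.
apply: lte_add_pinfty.
  apply: (le_lt_trans _ (ltry a^-1)); apply: le_trans (integral_powR_le1 a0).
  rewrite [leRHS]integral_mkcond le_eqVlt; apply/orP; left; apply/eqP.
  apply: eq_integral => t _; rewrite patchE /f indicE.
  by case: ifP => _; rewrite ?mul1r ?mul0r.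
have mpdf : measurable_fun setT (fun t : R => (exponential_pdf 2^-1 t)%R%:E).
  by apply/measurable_EFinP; exact: measurable_exponential_pdf.
rewrite [X in X < _](_ : _ = C%:E * \int[mu]_t (exponential_pdf 2^-1 t)%R%:E).
  by rewrite integral_exponential_pdf// mule1 ltry.
by rewrite -ge0_integral_lebesgueZl// => t; rewrite lee_fin.
Qed.

Lemma Gamma_integral a : (0 < a)%R ->
  \int[mu]_t (gamma_kernel a 1 t)%:E = (Gamma a)%:E.
Proof.
move=> a0; rewrite /Gamma /Rintegral ge0_integral_indic_itvoy.
rewrite [in RHS](_ : \int[mu]_x _ = \int[mu]_t (gamma_kernel a 1 t)%:E);
  last first.
  by apply: eq_integral => t _; rewrite /gamma_kernel mulr1 [(expR _ * _)%R]mulrC.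
rewrite fineK// ge0_fin_numE ?integral_gamma_kernel_lty//.
by apply: integral_ge0 => t _; rewrite lee_fin gamma_kernel_ge0.
Qed.

(** A zero integral would make the nonnegative kernel vanish almost everywhere, yet it is positive
    on ]0, 1[, of measure 1. *)
Lemma Gamma_gt0 a : (0 < a)%R -> (0 < Gamma a)%R.
Proof.
move=> a0; rewrite -lte_fin -Gamma_integral//.
have mk : measurable_fun setT (EFin \o gamma_kernel a 1).
  by apply/measurable_EFinP; exact: measurable_gamma_kernelr.
have k0 x : 0 <= (gamma_kernel a 1 x)%:E by rewrite lee_fin gamma_kernel_ge0.
rewrite lt_neqAle integral_ge0// andbT eq_sym; apply/eqP => I0.
have : ae_eq mu setT (EFin \o gamma_kernel a 1) (cst 0).
  apply/(ae_eq_integral_abs mu measurableT); first exact: mk.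
  rewrite -[RHS]I0; apply: eq_integral => x _; rewrite gee0_abs//; exact: k0.
case=> A [mA A0 sA].
have : mu `]0%R, 1%R[ <= mu A.
  apply: le_measure; rewrite ?inE//.
  move=> x; rewrite /= in_itv/= => /andP[x0 x1]; apply: sA => /= /(_ I) [] /eqP.
  rewrite /gamma_kernel indicE mem_setE in_itv/= x0 mul1r mulf_eq0.
  by rewrite !gt_eqF// ?expR_gt0// powR_gt0.
by rewrite A0 lebesgue_measure_itv/= lte01 sube0 lee_fin ler10.
Qed.

Lemma integral_gamma_kernel a s : (0 < a)%R -> (0 < s)%R ->
  \int[mu]_t (gamma_kernel a s t)%:E = (s `^ (- a) * Gamma a)%:E.
Proof.
move=> a0 s0.
have mk : measurable_fun setT (EFin \o gamma_kernel a 1).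
  by apply/measurable_EFinP; exact: measurable_gamma_kernelr.
have k0 x : 0 <= (gamma_kernel a 1 x)%:E by rewrite lee_fin gamma_kernel_ge0.
have := ge0_integral_affine 0 s0 mk k0.
rewrite /= Gamma_integral// -EFinM => E.
transitivity ((s `^ (- (a - 1)))%:E *
    \int[mu]_x (gamma_kernel a 1 (s * x + 0)%R)%:E).
  rewrite -ge0_integral_lebesgueZl ?powR_ge0//; last first.
    apply/measurable_EFinP; apply: measurable_gamma_kernel => //.
    exact: measurable_affine.
  apply: eq_integral => t _; rewrite -EFinM; congr EFin.
  rewrite /gamma_kernel !indicE !mem_setE !in_itv/= !andbT addr0 mulr1.
  rewrite pmulr_rgt0//; case: ltP => t0; last by rewrite !mul0r mulr0.
  rewrite !mul1r (powRM _ (ltW s0) (ltW t0)) !mulrA powRN mulVf ?mul1r.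
    by rewrite [(t * s)%R]mulrC.
  by rewrite gt_eqF// powR_gt0.
rewrite E -EFinM mulrA; congr ((_ * _)%:E).
rewrite -[(s^-1)%R]powR_inv1 ?(ltW s0)// -powRD ?(gt_eqF s0) ?implybT//.
by congr (_ `^ _)%R; ring.
Qed.

(** Write Gamma(a + b) (1 + t)^-(a+b) as the integral over s > 0 of s^(a+b-1) e^(-(1+t)s) and
    exchange the integrals. The t-integral becomes s^-a Gamma(a), and the s-integral left over is
    Gamma(b). *)
Lemma integral_beta_prime a b : (0 < a)%R -> (0 < b)%R ->
  \int[mu]_t (\1_`]0, +oo[ t * (t `^ (a - 1) * (1 + t) `^ (- (a + b))))%:E =
  (Beta a b)%:E.
Proof.
move=> a0 b0; have ab0 : (0 < a + b)%R by rewrite addr_gt0.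
set J := LHS.
have mJ : measurable_fun setT (fun t : R =>
    (\1_`]0, +oo[ t * (t `^ (a - 1) * (1 + t) `^ (- (a + b))))%:E).
  apply/measurable_EFinP; apply: measurable_funM; first exact: measurable_indic.
  apply: measurable_funM; first exact: measurable_powR.
  by apply: (measurableT_comp (measurable_powR _)); exact: measurable_funD.
suff GJ : (Gamma (a + b))%:E * J = (Gamma a * Gamma b)%:E.
  have : (Gamma (a + b))^-1%:E * ((Gamma (a + b))%:E * J) =
      (Gamma (a + b))^-1%:E * (Gamma a * Gamma b)%:E by rewrite GJ.
  rewrite muleA -!EFinM mulVf ?gt_eqF ?Gamma_gt0// mul1e => ->.
  by rewrite /Beta mulrC.
pose h (z : R * R) : R :=
  (\1_`]0, +oo[ z.1 * z.1 `^ (a - 1) * gamma_kernel (a + b) (1 + z.1) z.2)%R.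
have h0 z : 0 <= (h z)%:E.
  by rewrite lee_fin !mulr_ge0 ?gamma_kernel_ge0 ?powR_ge0// indicE ler0n.
have mh : measurable_fun setT (EFin \o h).
  apply/measurable_EFinP; apply: measurable_funM; last first.
    by apply: measurable_gamma_kernel => //; exact: measurable_funD.
  apply: measurable_funM.
    have mI : measurable_fun setT (\1_`]0%R, +oo[ : R -> R).
      by apply: measurable_indic; exact: measurable_itv.
    exact: (measurableT_comp mI measurable_fst).
  exact: (measurableT_comp (measurable_powR _) measurable_fst).
have := fubini_tonelli (m1 := mu) (m2 := mu) _ mh h0.
rewrite /= => hh.
transitivity (\int[mu]_x \int[mu]_y (h (x, y))%:E).
  rewrite /J -(ge0_integral_lebesgueZl (ltW (Gamma_gt0 ab0)) mJ); last first.
    by move=> t; rewrite lee_fin !mulr_ge0 ?powR_ge0// indicE ler0n.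
  apply: eq_integral => t _; rewrite /h /=.
  under eq_integral do rewrite EFinM.
  rewrite ge0_integral_lebesgueZl; last 3 first.
  - by rewrite mulr_ge0 ?powR_ge0// indicE ler0n.
  - by apply/measurable_EFinP; exact: measurable_gamma_kernelr.
  - by move=> y; rewrite lee_fin gamma_kernel_ge0.
  rewrite indicE mem_setE in_itv/= andbT; case: ltP => t0; last first.
    by rewrite !mul0r mul0e mule0.
  have t1 : (0 < 1 + t)%R by rewrite addr_gt0.
  rewrite (integral_gamma_kernel ab0 t1) -!EFinM !mul1r; congr (_%:E).
  by rewrite mulrC mulrA.
rewrite hh EFinM -(Gamma_integral b0) -ge0_integral_lebesgueZl; last 3 first.
- exact/ltW/Gamma_gt0.
- by apply/measurable_EFinP; exact: measurable_gamma_kernelr.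
- by move=> y; rewrite lee_fin gamma_kernel_ge0.
apply: eq_integral => s _.
transitivity (\int[mu]_t ((\1_`]0, +oo[ s * (s `^ (a + b - 1) * expR (- s)))%:E *
    (gamma_kernel a s t)%:E)).
  apply: eq_integral => t _; rewrite -EFinM; congr EFin.
  rewrite /h /gamma_kernel /= mulrDr mulr1 opprD expRD [(t * s)%R]mulrC; ring.
rewrite ge0_integral_lebesgueZl; last 3 first.
- by rewrite !mulr_ge0 ?powR_ge0 ?expR_ge0// indicE ler0n.
- by apply/measurable_EFinP; exact: measurable_gamma_kernelr.
- by move=> y; rewrite lee_fin gamma_kernel_ge0.
rewrite /gamma_kernel !indicE !mem_setE in_itv/= andbT.
case: ltP => s0; last by rewrite !mul0r mul0e mule0.
have -> : (s `^ (b - 1) = s `^ (a + b - 1) * s `^ (- a))%R.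
  have {1}-> : (b - 1 = a + b - 1 + - a)%R by ring.
  by apply: powRD; rewrite (gt_eqF s0) implybT.
rewrite (integral_gamma_kernel a0 s0) -!EFinM !mul1r mulr1; congr (_%:E).
move: (s `^ _)%R (s `^ _)%R (expR _) (Gamma a) => u v w x.
by ring.
Qed.

End gamma_function.

(** * Integrals over the positive definite cone *)

Section cone_integral.
Context {R : realType}.
Implicit Types (d : nat) (a : R).
Local Open Scope ereal_scope.

(** On the cone, |X|^(-(d+1)/2) dX is invariant under congruences, so [a] alone governs how
    integrals rescale. *)
Definition cone_density d a (X : 'M[R]_d) : R :=
  (\1_(posdef d) X * \det X `^ (a - (d%:R + 1) / 2))%R.

Lemma cone_density_ge0 d a (X : 'M[R]_d) : (0 <= cone_density a X)%R.
Proof. by rewrite mulr_ge0 ?powR_ge0// indicE ler0n. Qed.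

Lemma measurable_cone_density d a :
  measurable_fun setT (@cone_density d a).
Proof.
apply: measurable_funM.
  by apply: measurable_indic; exact: measurable_posdef.
apply: (@measurableT_comp _ _ _ _ _ _ (fun x : R => x `^ _)%R).
  exact: measurable_powR.
by apply: measurable_det; exact: measurable_id.
Qed.

Definition cone_integral d a (H : 'M[R]_d -> \bar R) : \bar R :=
  \int[lebesgue_sym d]_X ((cone_density a X)%:E * H X).

Lemma eq_cone_integral d a (H1 H2 : 'M[R]_d -> \bar R) :
  (forall X, posdef d X -> H1 X = H2 X) ->
  cone_integral a H1 = cone_integral a H2.
Proof.
move=> H12; apply: eq_integral => X _; rewrite /cone_density indicE.
have [/set_mem/H12->//|_] := boolP (X \in posdef d).
by rewrite !mul0r !mul0e.
Qed.

Lemma measurable_cone_integrand d a (H : 'M[R]_d -> \bar R) :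
  measurable_fun setT H ->
  measurable_fun setT (fun X => (cone_density a X)%:E * H X).
Proof.
move=> mH; apply: emeasurable_funM => //.
by apply/measurable_EFinP; exact: measurable_cone_density.
Qed.

Lemma ge0_cone_integralZl d a (c : R) (H : 'M[R]_d -> \bar R) : (0 <= c)%R ->
  measurable_fun setT H -> (forall X, 0 <= H X) ->
  cone_integral a (fun X => c%:E * H X) = c%:E * cone_integral a H.
Proof.
move=> c0 mH H0; rewrite /cone_integral.
under eq_integral do rewrite muleCA.
rewrite ge0_integralZl_EFin//.
- by move=> X _; rewrite mule_ge0// lee_fin cone_density_ge0.
- exact: measurable_cone_integrand.
Qed.

Lemma cone_integral_ge0 d a (H : 'M[R]_d -> \bar R) :
  (forall X, 0 <= H X) -> 0 <= cone_integral a H.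
Proof.
move=> H0; apply: integral_ge0 => X _.
by rewrite mule_ge0// lee_fin cone_density_ge0.
Qed.

Lemma cone_density_congr d a (C X : 'M[R]_d) : pos_trig C ->
  cone_density a (C *m X *m C^T)%R =
  ((\det C `^ (2 * a) / \det C ^+ d.+1) * cone_density a X)%R.
Proof.
move=> CT; have C0 := pos_trig_det CT.
have Cu := pos_trig_unit CT.
rewrite /cone_density !indicE.
have -> : ((C *m X *m C^T)%R \in posdef d) = (X \in posdef d).
  by apply/idP/idP => /set_mem/posdef_congrE h; apply/mem_set; exact: h.
have [/set_mem/posdef_det_gt0 X0|_] := boolP (X \in posdef d);
  last by rewrite !mul0r mulr0.
rewrite !mul1r !det_mulmx det_tr mulrAC -expr2.
rewrite powRM ?exprn_ge0 ?(ltW C0) ?(ltW X0)//; congr (_ * _)%R.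
rewrite -(powR_mulrn _ (ltW C0)) -powRrM -(powR_mulrn _ (ltW C0)) -powRB.
  by congr (_ `^ _)%R; rewrite -natr1; field.
by rewrite (gt_eqF C0) implybT.
Qed.

(** The factor (det C)^-(d+1) picked up by the density cancels against the Jacobian of the
    congruence, and only (det C)^(-2a) survives. *)
Lemma cone_integral_congr d a (C : 'M[R]_d) (H : 'M[R]_d -> \bar R) :
  pos_trig C -> measurable_fun setT H -> (forall X, 0 <= H X) ->
  cone_integral a (fun X => H (C *m X *m C^T)%R) =
  (\det C `^ (- (2 * a)))%:E * cone_integral a H.
Proof.
move=> CT mH H0; have C0 := pos_trig_det CT.
have mF := measurable_cone_integrand a mH.
have F0 X : 0 <= (cone_density a X)%:E * H X.
  by rewrite mule_ge0// lee_fin cone_density_ge0.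
have := ge0_integral_sym_congr CT mF F0.
pose c := (\det C `^ (2 * a) / \det C ^+ d.+1)%R.
have c0 : (0 < c)%R by rewrite divr_gt0 ?powR_gt0 ?exprn_gt0.
have mHC : measurable_fun setT (fun X : 'M[R]_d => H (C *m X *m C^T)%R).
  apply: measurableT_comp mH _; apply: measurable_mulmx => //.
  exact: measurable_mulmx.
rewrite [X in X = _ -> _](_ : _ =
    c%:E * cone_integral a (fun X => H (C *m X *m C^T)%R)); last first.
  rewrite -ge0_cone_integralZl ?(ltW c0)//.
  apply: eq_integral => X _; rewrite cone_density_congr// EFinM.
  by rewrite muleCA muleA.
move=> E; have cV : c^-1%:E * c%:E = 1 by rewrite -EFinM mulVf// gt_eqF.
rewrite -[LHS]mul1e -cV -muleA E muleA -EFinM; congr (_%:E * _).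
rewrite /c invfM invrK powRN -mulrA divff ?mulr1// expf_neq0//.
by rewrite gt_eqF.
Qed.

(** Scaling by s is the congruence by the scalar matrix of the square root of s, whose determinant
    is s^(d/2). *)
Lemma cone_integral_scale d a (s : R) (H : 'M[R]_d -> \bar R) : (0 < s)%R ->
  measurable_fun setT H -> (forall X, 0 <= H X) ->
  cone_integral a (fun X => H (s *: X)%R) =
  (s `^ (- (a * d%:R)))%:E * cone_integral a H.
Proof.
move=> s0 mH H0; have sq0 : (0 < Num.sqrt s)%R by rewrite sqrtr_gt0.
have := cone_integral_congr a (pos_trig_scalar d sq0) mH H0.
rewrite det_scalar => E; rewrite [LHS](_ : _ =
    cone_integral a (fun X => H ((Num.sqrt s)%:M *m X *m ((Num.sqrt s)%:M)^T)%R)).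
  rewrite E; congr (_%:E * _).
  rewrite -powR12_sqrt ?(ltW s0)// -powR_mulrn ?powR_ge0// -!powRrM.
  by congr (_ `^ _)%R; field.
apply: eq_cone_integral => X _; rewrite tr_scalar_mx mul_mx_scalar mul_scalar_mx.
by rewrite scalerA -expr2 sqr_sqrtr ?(ltW s0).
Qed.

Lemma integral_gauss_col n :
  \int[lebesgue_tuple n]_u
    (expR (- ((col_of_tuple u)^T *m col_of_tuple u) 0 0))%:E =
  (Num.sqrt pi ^+ n : R)%:E.
Proof.
elim: n => [|n IH].
  rewrite ge0_integral_lebesgue_tuple0 => [||t]; last by rewrite lee_fin expR_ge0.
    by rewrite mxE big_ord0 oppr0 expR0 expr0.
  apply/measurable_EFinP; apply: measurableT_comp => //.
  apply: measurableT_comp => //; apply: measurable_mx_entry.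
  apply: measurable_mulmx; last exact: measurable_col_of_tuple.
  by apply: measurable_trmx; exact: measurable_col_of_tuple.
rewrite -addn1.
pose F m (u : 'cV[R]_m) := (expR (- (u^T *m u) 0 0))%:E.
have F0 m u : 0 <= @F m u by rewrite lee_fin expR_ge0.
have mF m : measurable_fun setT (@F m).
  apply/measurable_EFinP; apply: measurableT_comp => //.
  apply: measurableT_comp => //; apply: measurable_mx_entry.
  by apply: measurable_mulmx => //; exact: measurable_trmx.
rewrite (ge0_integral_col (mF (n + 1)%N) (F0 (n + 1)%N)).
transitivity (\int[lebesgue_tuple n]_v
    ((Num.sqrt pi)%:E * F n (col_of_tuple v))).
  apply: eq_integral => v _.
  rewrite -integralT_gauss [RHS]muleC -ge0_integral_lebesgueZl.
  - apply: eq_integral => x _; rewrite /F /gauss_fun -EFinM -expRD.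
    rewrite -opprD; congr ((expR (- _))%:E).
    rewrite tr_col_mx mul_row_col mxE; congr (_ + _)%R.
    by rewrite tr_scalar_mx -scalar_mxM mxE eqxx expr2.
  - exact: expR_ge0.
  - by apply/measurable_EFinP; exact: measurable_gauss_fun.
  - by move=> x; rewrite lee_fin gauss_fun_ge0.
rewrite ge0_integralZl_EFin ?sqrtr_ge0//.
  by rewrite IH -EFinM addn1 exprS.
exact: measurableT_comp (mF n) (@measurable_col_of_tuple R n).
Qed.

(** Kept in the extended reals because [mvGamma] takes [fine] of the integral and would turn +oo
    into 0; finiteness is settled on this version. *)
Definition mvGamma_ereal d a :=
  cone_integral a (fun X : 'M[R]_d => (expR (- \tr X))%:E).

Lemma measurable_expR_trace d :
  measurable_fun setT (fun X : 'M[R]_d => (expR (- \tr X))%:E).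
Proof.
apply/measurable_EFinP; apply: measurableT_comp => //.
apply: measurableT_comp => //.
exact: (measurable_mxtrace (@measurable_id _ _ setT)).
Qed.

(* Writing Y = L L^T for the leading block of X, v = L u for the last column
   and z + u^T u for the last entry, X is positive definite iff z > 0, and
   det X = det Y * z. *)
Lemma mvGamma_erealS n a : ((n%:R / 2) < a)%R ->
  mvGamma_ereal (n + 1) a =
  (Num.sqrt pi ^+ n * Gamma (a - n%:R / 2))%:E * mvGamma_ereal n a.
Proof.
move=> na; have an0 : (0 < a - n%:R / 2)%R by rewrite subr_gt0.
pose b := (a - ((n + 1)%:R + 1) / 2)%R.
(* The exponent of z, written as that of the integrand of Gamma(a - n/2). *)
have bE : (b = a - n%:R / 2 - 1)%R by rewrite /b natrD; field.
pose F (X : 'M[R]_(n + 1)) := (cone_density a X)%:E * (expR (- \tr X))%:E.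
have mF : measurable_fun setT F.
  by apply: measurable_cone_integrand; exact: measurable_expR_trace.
have F0 X : 0 <= F X by rewrite mule_ge0// lee_fin ?cone_density_ge0 ?expR_ge0.
rewrite /mvGamma_ereal [LHS](ge0_integral_sym_bordered mF F0).
pose K : R := (Num.sqrt pi ^+ n * Gamma (a - n%:R / 2))%R.
have K0 : (0 <= K)%R by rewrite mulr_ge0 ?exprn_ge0 ?sqrtr_ge0// ltW// Gamma_gt0.
have E0 (X : 'M[R]_n) : 0 <= (expR (- \tr X))%:E by rewrite lee_fin expR_ge0.
rewrite -(ge0_cone_integralZl a K0 (@measurable_expR_trace n) E0).
rewrite /cone_integral ge0_integral_sym; last 2 first.
- apply: measurable_cone_integrand; apply: emeasurable_funM => //.
  exact: measurable_expR_trace.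
- by move=> X; rewrite !mule_ge0// lee_fin ?cone_density_ge0 ?expR_ge0.
apply: eq_integral => u _; move: (sym_of_tuple u) => Y.
(* Off the cone both sides vanish, since the leading block of a positive definite matrix is positive
   definite. *)
have [/set_mem Yp|Yp] := boolP (Y \in posdef n); last first.
  rewrite [RHS](_ : _ = 0); last first.
    by rewrite /cone_density indicE (negbTE Yp) mul0r mul0e.
  rewrite integral0_eq// => w _; rewrite /F /cone_density indicE.
  rewrite (_ : _ \in _ = false) ?mul0r ?mul0e//; apply/negbTE/negP.
  by move=> /set_mem/posdef_bordered/mem_set; exact/negP.
have [L LT YE] := cholesky Yp; have L0 := pos_trig_det LT.
have mFb : measurable_fun setT (fun c => F (bordered Y c)).
  by apply: measurableT_comp mF _; apply: measurable_bordered.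
rewrite (ge0_integral_col mFb (fun c => F0 _)).
have mG := measurable_integral_col mFb (fun c => F0 _).
have G0 (v : 'cV[R]_n) :
  0 <= \int[lebesgue_measure]_x F (bordered Y (col_mx v x%:M)).
  exact: integral_ge0.
set G := LHS.
have E : \int[lebesgue_tuple n]_v \int[lebesgue_measure]_x
    F (bordered Y (col_mx (L *m col_of_tuple v + 0)%R x%:M)) =
    (\det L)^-1%:E * G := ge0_integral_col_affine 0 LT mG G0.
have {E} -> : G = (\det L)%:E * \int[lebesgue_tuple n]_v
    \int[lebesgue_measure]_x
      F (bordered Y (col_mx (L *m col_of_tuple v)%R x%:M)).
  transitivity ((\det L)%:E * ((\det L)^-1%:E * G)).
    by rewrite muleA -EFinM divff ?mul1e// gt_eqF.
  congr (_ * _); apply: etrans (esym E) _; apply: eq_integral => v _.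
  by rewrite addr0.
pose c : R := (\det Y `^ b * expR (- \tr Y))%R.
have c0 : (0 <= c)%R by rewrite mulr_ge0 ?powR_ge0 ?expR_ge0.
have innerE (v : 'cV[R]_n) :
    \int[lebesgue_measure]_x F (bordered Y (col_mx (L *m v)%R x%:M)) =
    (c * Gamma (a - n%:R / 2))%:E * (expR (- (v^T *m v) 0 0))%:E.
  have mx : measurable_fun [set: R] (fun x =>
      F (bordered Y (col_mx (L *m v)%R x%:M))).
    apply: (measurableT_comp mFb).
    by apply: measurable_col_mx => //; exact: measurable_scalar_mx.
  (* A shift of slope 1 that makes the Schur complement the variable of integration. *)
  have := ge0_integral_affine ((v^T *m v) 0 0)%R ltr01 mx (fun x => F0 _).
  rewrite invr1 mul1e => <-.
  transitivity (\int[lebesgue_measure]_z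
      ((c * expR (- (v^T *m v) 0 0))%:E * (gamma_kernel (a - n%:R / 2) 1 z)%:E)).
    apply: eq_integral => z _; rewrite /F /cone_density mul1r.
    rewrite YE -!EFinM; congr EFin; rewrite /gamma_kernel !indicE.
    rewrite det_bordered_chol mem_setE in_itv/= andbT.
    have -> : ((bordered (L *m L^T) (col_mx (L *m v)
        (z + (v^T *m v) 0 0)%:M) \in posdef (n + 1)) = (0 < z))%R.
      apply/idP/idP => [/set_mem/(posdef_bordered_chol _ _ LT)//|z0].
      exact/mem_set/posdef_bordered_chol.
    case: ltP => z0; last by rewrite !mul0r mulr0.
    rewrite !mul1r mulr1 powRM ?exprn_ge0 ?(ltW L0) ?(ltW z0)//.
    rewrite -/b -bE /c YE det_mulmx det_tr -expr2.
    rewrite /bordered mxtrace_block col_mxKd mxtrace_scalar.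
    rewrite !opprD !expRD.
    move: (_ `^ _)%R (_ `^ _)%R (expR _) (expR _) (expR _) => p q r s t.
    by ring.
  rewrite ge0_integral_lebesgueZl; last 3 first.
  - by rewrite mulr_ge0 ?expR_ge0.
  - by apply/measurable_EFinP; exact: measurable_gamma_kernelr.
  - by move=> z; rewrite lee_fin gamma_kernel_ge0.
  by rewrite Gamma_integral// -!EFinM mulrAC.
under eq_integral do rewrite innerE.
rewrite ge0_integralZl_EFin//; last 2 first.
- apply/measurable_EFinP; apply: measurableT_comp => //.
  apply: measurableT_comp => //; apply: measurable_mx_entry.
  apply: measurable_mulmx; last exact: measurable_col_of_tuple.
  by apply: measurable_trmx; exact: measurable_col_of_tuple.
- by rewrite mulr_ge0// ltW// Gamma_gt0.
rewrite integral_gauss_col /cone_density indicE mem_set// mul1r -!EFinM.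
(* The exponents of sizes n and n + 1 differ by 1/2, and (det Y)^(1/2) = det L is precisely the
   Jacobian of v = L u. *)
have -> : (\det Y `^ (a - (n%:R + 1) / 2) = \det L * \det Y `^ b)%R.
  rewrite YE det_mulmx det_tr -expr2 -!(powR_mulrn 2 (ltW L0)) -!powRrM.
  rewrite -{2}(powRr1 (ltW L0)) -powRD; last by rewrite (gt_eqF L0) implybT.
  by congr (_ `^ _)%R; rewrite bE; field.
rewrite /c /K; congr EFin.
move: (_ `^ _)%R (expR _) (Gamma _) (\det L) (_ ^+ _)%R => p q r s t.
by ring.
Qed.

End cone_integral.

(** * Integration against a measure given by a density *)

Section density.
Context d (T : measurableType d) (R : realType).
Variables (mu nu : {measure set T -> \bar R}) (f : T -> R).
Local Open Scope ereal_scope.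
Import HBNNSimple.

(** The hypothesis on [nu] is the case of indicators; linearity gives simple functions and monotone
    convergence the rest. It turns [is_Wishart], a statement on sets, into a formula for
    expectations. *)
Lemma ge0_integral_density (g : T -> \bar R) :
  measurable_fun setT f -> (forall x, 0 <= f x)%R ->
  (forall A, measurable A -> nu A = \int[mu]_(x in A) (f x)%:E) ->
  measurable_fun setT g -> (forall x, 0 <= g x) ->
  \int[nu]_x g x = \int[mu]_x ((f x)%:E * g x).
Proof.
move=> mf f0 nuE mg g0.
have mfE : measurable_fun setT (fun x => (f x)%:E) by exact/measurable_EFinP.
pose g_ := nnsfun_approx measurableT mg.
have limg x : (g_ n x)%:E @[n --> \oo] --> g x by exact: cvg_nnsfun_approx.
have mg_ n : measurable_fun setT (fun x => (g_ n x)%:E).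
  by apply/measurable_EFinP; exact: measurable_funP.
have g_0 n x : 0 <= (g_ n x)%:E by rewrite lee_fin.
have nd_g x : {homo (fun n => (g_ n x)%:E) : n m / (n <= m)%N >-> n <= m}.
  by move=> n m nm; rewrite lee_fin; exact/lefP/nd_nnsfun_approx.
have step n : \int[nu]_x (g_ n x)%:E = \int[mu]_x ((f x)%:E * (g_ n x)%:E).
  rewrite integralT_nnsfun sintegralE.
  transitivity (\int[mu]_x \sum_(k \in range (g_ n))
      ((f x)%:E * (k * \1_(g_ n @^-1` [set k]) x)%:E)); last first.
    apply: eq_integral => x _; rewrite -ge0_mule_fsumr; last first.
      by move=> k; rewrite EFinM nnfun_muleindic_ge0.
    by rewrite fsumEFin// -fimfunE.
  rewrite ge0_integral_fsum//; last 2 first.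
  - move=> k; apply: emeasurable_funM => //; apply/measurable_EFinP.
    by apply: measurable_funM => //; exact: measurable_indic.
  - move=> k x _; rewrite mule_ge0 ?lee_fin// -lee_fin EFinM.
    exact: nnfun_muleindic_ge0.
  apply: eq_fsbigr => k; rewrite inE => -[y _ <-].
  have mA : measurable (g_ n @^-1` [set g_ n y]).
    by rewrite -[X in measurable X]setTI; exact: measurable_funP.
  rewrite nuE// integral_mkcond -ge0_integralZl_EFin//.
  - apply: eq_integral => x _; rewrite patchE indicE EFinM.
    by case: ifP => _; rewrite ?mule1 ?mule0// muleC.
  - by move=> x _; apply: erestrict_ge0 => z _; rewrite lee_fin.
  - by apply/(measurable_restrictT (EFin \o f)) => //; exact: measurable_funTS.
transitivity (limn (fun n => \int[nu]_x (g_ n x)%:E)).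
  rewrite -monotone_convergence//.
  by apply: eq_integral => x _; apply/esym/cvg_lim => //; exact: limg.
rewrite (funext step) -monotone_convergence//.
- by apply: eq_integral => x _; apply/cvg_lim => //; exact: cvgeZl.
- by move=> n; exact: emeasurable_funM.
- by move=> n x _; rewrite mule_ge0// lee_fin.
- move=> x _ n m nm; apply: lee_wpmul2l; last exact: nd_g.
  by rewrite lee_fin.
Qed.

End density.

(** * Finiteness of the multivariate Gamma function, and homogeneous functions on the cone *)

Section multivariate_gamma.
Context {R : realType}.
Implicit Types (d : nat) (a : R).
Local Open Scope ereal_scope.

(** Each step of [mvGamma_erealS] multiplies by a positive real. The hypothesis for size d + 1 is
    d/2 < a, just what Gamma(a - d/2) needs, and it implies the hypotheses for all smaller sizes. *)
Lemma mvGamma_ereal_fin d a : ((d%:R - 1) / 2 < a)%R ->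
  exists2 K : R, (0 < K)%R & mvGamma_ereal d a = K%:E.
Proof.
elim: d => [_|d IH da].
  (* In size 0 the measure is a Dirac mass at the empty matrix, of determinant 1 and trace 0. *)
  exists 1%R; rewrite ?ltr01// /mvGamma_ereal /cone_integral.
  rewrite ge0_integral_sym; last 2 first.
  - by apply: measurable_cone_integrand; exact: measurable_expR_trace.
  - by move=> X; rewrite mule_ge0// lee_fin ?cone_density_ge0 ?expR_ge0.
  rewrite integral_dirac//; last first.
    apply: (@measurableT_comp _ _ _ _ _ _
      (fun X => (cone_density a X)%:E * (expR (- \tr X))%:E)).
      by apply: measurable_cone_integrand; exact: measurable_expR_trace.
    exact: measurable_sym_of_tuple.
  rewrite diracE in_setT mul1e /cone_density det_mx00 powR1 mulr1.
  rewrite /mxtrace big_ord0 oppr0 expR0 mule1 indicE mem_set//.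
  by split=> [|v]; [rewrite [LHS]flatmx0 [RHS]flatmx0|rewrite flatmx0 eqxx].
have da' : (d%:R / 2 < a)%R by move: da; rewrite -natr1 addrK.
have [|K K0 IK] := IH; first by apply: le_lt_trans da'; lra.
exists (Num.sqrt pi ^+ d * Gamma (a - d%:R / 2) * K)%R.
  by rewrite !mulr_gt0 ?exprn_gt0 ?sqrtr_gt0 ?pi_gt0// Gamma_gt0// subr_gt0.
by rewrite -addn1 mvGamma_erealS// IK.
Qed.

Lemma integral_posdef d a (g : 'M[R]_d -> R) :
  \int[lebesgue_sym d]_(X in posdef d)
    (g X * \det X `^ (a - (d%:R + 1) / 2))%:E =
  cone_integral a (fun X => (g X)%:E).
Proof.
rewrite integral_mkcond; apply: eq_integral => X _.
rewrite patchE /cone_density indicE -EFinM.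
by case: ifP => _; rewrite ?mul0r// mul1r mulrC.
Qed.

Lemma mvGamma_erealE d a : ((d%:R - 1) / 2 < a)%R ->
  mvGamma_ereal d a = (mvGamma d a)%:E.
Proof.
move=> /mvGamma_ereal_fin[K _ KE].
by rewrite /mvGamma /Rintegral integral_posdef -/(mvGamma_ereal d a) KE.
Qed.

Lemma mvGamma_gt0 d a : ((d%:R - 1) / 2 < a)%R -> (0 < mvGamma d a)%R.
Proof.
move=> da; have [K K0 KE] := mvGamma_ereal_fin da.
by rewrite -lte_fin -mvGamma_erealE// KE lte_fin.
Qed.

(** Cyclicity of the trace. For X in the cone, tr(Sigma^-1 X) thereby becomes the trace of a
    positive definite matrix congruent to X. *)
Lemma mxtrace_invmx_mul_tr d (C X : 'M[R]_d) : C \in unitmx ->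
  \tr (invmx (C *m C^T) *m X) = \tr (invmx C *m X *m (invmx C)^T).
Proof.
move=> Cu; have CTu : C^T%R \in unitmx by rewrite unitmx_tr.
have -> : invmx (C *m C^T) = ((invmx C)^T *m invmx C)%R.
  have E : (C *m C^T *m ((invmx C)^T *m invmx C) = 1%:M)%R.
    rewrite -(mulmxA C) (mulmxA C^T%R) -trmx_mul mulVmx// trmx1 mul1mx.
    by rewrite mulmxV.
  by rewrite -[RHS](@mulKmx _ _ _ (C *m C^T)%R) ?unitmx_mul ?Cu// E mulmx1.
by rewrite -mulmxA mxtrace_mulC.
Qed.

Lemma measurable_expR_trace_mul d (S : 'M[R]_d) (s : R) :
  measurable_fun setT (fun X : 'M[R]_d => (expR (- (s * \tr (S *m X))))%:E).
Proof.
apply/measurable_EFinP; apply: measurableT_comp => //.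
apply: measurableT_comp => //; apply: measurable_funM => //.
by apply: measurable_mxtrace; exact: measurable_mulmx.
Qed.

(** Scaling removes s, and the congruence by the Cholesky factor C removes Sigma, with det Sigma =
    (det C)^2. *)
Lemma cone_integral_expR d a (Sigma : 'M[R]_d) (s : R) :
  ((d%:R - 1) / 2 < a)%R -> posdef d Sigma -> (0 < s)%R ->
  cone_integral a (fun X => (expR (- (s * \tr (invmx Sigma *m X))))%:E) =
  (s `^ (- (a * d%:R)) * (\det Sigma `^ a * mvGamma d a))%:E.
Proof.
move=> da Sp s0; have [C CT SE] := cholesky Sp.
have Cu := pos_trig_unit CT; have C0 := pos_trig_det CT.
pose H (X : 'M[R]_d) := (expR (- (1 * \tr (invmx Sigma *m X))))%:E.
have mH : measurable_fun setT H by exact: measurable_expR_trace_mul.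
have H0 X : 0 <= H X by rewrite lee_fin expR_ge0.
rewrite (@eq_cone_integral _ _ _ _ (fun X => H (s *: X)%R)); last first.
  by move=> X _; rewrite /H mul1r -scalemxAr mxtraceZ.
rewrite cone_integral_scale// EFinM; congr (_ * _).
have HC X : H (C *m X *m C^T)%R = (expR (- \tr X))%:E.
  rewrite /H mul1r; congr ((expR (- _))%:E).
  rewrite SE mxtrace_invmx_mul_tr// !mulmxA mulVmx// mul1mx -mulmxA -trmx_mul.
  by rewrite mulVmx// trmx1 mulmx1.
have := cone_integral_congr a CT mH H0.
rewrite (@eq_cone_integral _ _ _ _ (fun X => (expR (- \tr X))%:E)) => [E|X _];
  last exact: HC.
have {E} E : (mvGamma d a)%:E = (\det C `^ (- (2 * a)))%:E * cone_integral a H.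
  by rewrite -E -mvGamma_erealE.
have detS : (\det Sigma `^ a = \det C `^ (2 * a))%R.
  by rewrite SE det_mulmx det_tr -expr2 -(powR_mulrn 2 (ltW C0)) -powRrM.
rewrite EFinM E muleA -EFinM detS powRN divff ?mul1e//.
by rewrite gt_eqF// powR_gt0.
Qed.

Lemma cone_integral_homogeneous d (eta : R) (k : nat) (h : 'M[R]_d.+1 -> R)
    (Sigma : 'M[R]_d.+1) :
  (0 < eta)%R -> (0 < k)%N -> posdef d.+1 Sigma ->
  measurable_fun setT h -> (forall X, 0 <= h X)%R ->
  (forall t X, 0 < t -> h (t *: X) = t ^+ k * h X)%R ->
  let s (X : 'M[R]_d.+1) := \tr (invmx Sigma *m X) in
  let a := (eta * d.+1%:R)%R in
  (Gamma a)%:E *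
    cone_integral eta (fun X => (h X * (expR (- s X) / s X `^ a))%:E) =
  (Beta a k%:R)%:E * cone_integral eta (fun X => (h X * expR (- s X))%:E).
Proof.
move=> eta0 k0 Sp mh h0 hZ s a.
have a0 : (0 < a)%R by rewrite mulr_gt0// ltr0n.
have ms : measurable_fun setT s.
  by apply: measurable_mxtrace; exact: measurable_mulmx.
have s_gt0 X : posdef d.+1 X -> (0 < s X)%R.
  have [C CT SE] := cholesky Sp; have Cu := pos_trig_unit CT.
  move=> Xp; have : posdef d.+1 (invmx C *m X *m (invmx C)^T).
    by apply: posdef_congr => //; rewrite unitmx_inv.
  by move=> /posdef_trace_gt0; rewrite -mxtrace_invmx_mul_tr// -SE.
pose H X := (h X * expR (- s X))%:E.
have mH : measurable_fun setT H.
  apply/measurable_EFinP; apply: measurable_funM => //.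
  by apply: measurableT_comp => //; exact: measurableT_comp.
have H0 X : 0 <= H X by rewrite lee_fin mulr_ge0// expR_ge0.
pose N := (d.+1 * d.+2)./2.
(* The joint integrand in (X, t). It lives on tuples because [lebesgue_tuple] carries the
   sigma-finiteness that Tonelli requires. *)
pose Phi (z : N.-tuple R * measurableTypeR R) : \bar R :=
  let X := sym_of_tuple z.1 in
  (cone_density eta X)%:E * (H X * (gamma_kernel a (s X) z.2)%:E).
have Phi0 z : 0 <= Phi z.
  by rewrite !mule_ge0// lee_fin ?cone_density_ge0 ?gamma_kernel_ge0.
have mS : measurable_fun setT (fun z : N.-tuple R * measurableTypeR R =>
    sym_of_tuple z.1 : 'M[R]_d.+1).
  exact: (measurableT_comp (@measurable_sym_of_tuple R d.+1) measurable_fst).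
have mPhi : measurable_fun setT Phi.
  apply: emeasurable_funM.
    apply/measurable_EFinP.
    exact: (measurableT_comp (@measurable_cone_density R d.+1 eta) mS).
  apply: emeasurable_funM; first exact: (measurableT_comp mH mS).
  apply/measurable_EFinP; apply: measurable_gamma_kernel => //.
  exact: (measurableT_comp ms mS).
have swap := fubini_tonelli (m1 := lebesgue_tuple N) (m2 := lebesgue_measure)
  _ mPhi Phi0.
transitivity (\int[lebesgue_tuple N]_u \int[lebesgue_measure]_t Phi (u, t)).
  have mJ : measurable_fun setT (fun X => (h X * (expR (- s X) / s X `^ a))%:E).
    apply/measurable_EFinP; apply: measurable_funM => //.
    rewrite (_ : (fun _ => _) = fun X => (expR (- s X) * s X `^ (- a))%R).
      apply: measurable_funM.
        by apply: measurableT_comp => //; exact: measurableT_comp.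
      exact: (measurableT_comp (measurable_powR _) ms).
    by apply/funext => X; rewrite powRN.
  have J0 X : 0 <= (h X * (expR (- s X) / s X `^ a))%:E.
    by rewrite lee_fin mulr_ge0// divr_ge0 ?expR_ge0 ?powR_ge0.
  rewrite -ge0_cone_integralZl ?(ltW (Gamma_gt0 a0))//.
  rewrite /cone_integral ge0_integral_sym; last 2 first.
  - by apply: measurable_cone_integrand; exact: emeasurable_funM.
  - move=> X; rewrite !mule_ge0// lee_fin ?cone_density_ge0//.
    exact/ltW/Gamma_gt0.
  apply: eq_integral => u _; rewrite /Phi /=; move: (sym_of_tuple u) => X.
  have [Xp|Xp] := boolP (X \in posdef d.+1); last first.
    rewrite integral0_eq => [|t _]; rewrite /cone_density indicE (negbTE Xp);
      by rewrite mul0r mul0e.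
  have sX0 := s_gt0 _ (set_mem Xp).
  transitivity ((cone_density eta X * (h X * expR (- s X)))%:E *
      \int[lebesgue_measure]_t (gamma_kernel a (s X) t)%:E); last first.
    rewrite -ge0_integral_lebesgueZl.
    - by apply: eq_integral => t _; rewrite /H EFinM muleA.
    - apply: mulr_ge0; first exact: cone_density_ge0.
      by rewrite mulr_ge0// expR_ge0.
    - by apply/measurable_EFinP; exact: measurable_gamma_kernelr.
    - by move=> t; rewrite lee_fin gamma_kernel_ge0.
  rewrite integral_gamma_kernel// -!EFinM powRN; congr (_%:E).
  move: (_ `^ _)%R (expR _) (Gamma _) (h X) (cone_density _ _) => u1 u2 u3 u4 u5.
  by ring.
rewrite swap.
transitivity (\int[lebesgue_measure]_t (cone_integral eta H *
    (\1_`]0, +oo[ t * (t `^ (a - 1) * (1 + t) `^ (- (a + k%:R))))%:E)).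
  apply: eq_integral => t _.
  have [t0|t0] := ltP 0%R t; last first.
    rewrite indicE mem_setE in_itv/= andbT (le_gtF t0) mul0r mule0.
    rewrite integral0_eq// => u _; rewrite /Phi /gamma_kernel /=.
    by rewrite indicE mem_setE in_itv/= andbT (le_gtF t0) mul0r !mule0.
  have t1 : (0 < 1 + t)%R by rewrite addr_gt0.
  (* Rescaling by 1 + t costs (1 + t)^-a from the cone density and (1 + t)^-k from the homogeneity
     of [h]. *)
  have E := cone_integral_scale eta t1 mH H0.
  have {E} E : cone_integral eta H * ((1 + t) `^ (- (a + k%:R)))%:E =
      cone_integral eta (fun X => (h X * expR (- ((1 + t) * s X)))%:E).
    rewrite opprD powRD; last by rewrite (gt_eqF t1) implybT.
    rewrite mulrC EFinM muleCA [X in _ * X]muleC -E.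
    have mHt : measurable_fun setT (fun X : 'M[R]_d.+1 => H ((1 + t) *: X)%R).
      by apply: measurableT_comp mH _; exact: measurable_scalemx.
    have c0 : (0 <= (1 + t) `^ (- k%:R))%R by exact: powR_ge0.
    rewrite -(ge0_cone_integralZl eta c0 mHt (fun X => H0 _)).
    apply: eq_cone_integral => X _; rewrite /H hZ// -EFinM; congr (_%:E).
    rewrite powRN powR_mulrn ?(ltW t1)// !mulrA mulVf ?mul1r.
      by rewrite /s -scalemxAr mxtraceZ.
    by rewrite expf_neq0// gt_eqF.
  rewrite mulrA EFinM muleCA E -/(cone_integral _ _).
  rewrite indicE mem_setE in_itv/= andbT t0 mul1r.
  have mE : measurable_fun setT
      (fun X : 'M[R]_d.+1 => (h X * expR (- ((1 + t) * s X)))%:E).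
    apply/measurable_EFinP; apply: measurable_funM => //.
    apply: measurableT_comp => //; apply: measurableT_comp => //.
    exact: measurable_funM.
  have hE0 X : 0 <= (h X * expR (- ((1 + t) * s X)))%:E.
    by rewrite lee_fin mulr_ge0// expR_ge0.
  have c0 : (0 <= t `^ (a - 1))%R by exact: powR_ge0.
  rewrite -(ge0_cone_integralZl eta c0 mE hE0) /cone_integral ge0_integral_sym.
  - apply: eq_integral => u _; rewrite /Phi /=; congr (_ * _).
    rewrite /H /gamma_kernel indicE mem_setE in_itv/= andbT t0 -!EFinM.
    congr (_%:E); rewrite mulrDl !mul1r opprD expRD.
    move: (_ `^ _)%R (expR _) (expR _) (h _) => u1 u2 u3 u4.
    by ring.
  - by apply: measurable_cone_integrand; exact: emeasurable_funM.
  - by move=> X; rewrite !mule_ge0// lee_fin ?cone_density_ge0 ?powR_ge0.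
rewrite ge0_integralZl//; last 3 first.
- apply/measurable_EFinP; apply: measurable_funM; first exact: measurable_indic.
  apply: measurable_funM; first exact: measurable_powR.
  by apply: (measurableT_comp (measurable_powR _)); exact: measurable_funD.
- by move=> t _; rewrite lee_fin !mulr_ge0 ?powR_ge0// indicE ler0n.
- exact: cone_integral_ge0.
by rewrite integral_beta_prime ?ltr0n// muleC.
Qed.

End multivariate_gamma.

(** * Homogeneous functions *)

Section forms.
Context {R : realType} (d : nat).
Implicit Types (h : 'M[R]_d -> R) (k : nat).

Definition entry_norm (X : 'M[R]_d) : R := \sum_i \sum_j `|X i j|.

(** Homogeneity feeds the integral identity. The growth bound, stable under sums and products,
    supplies integrability. *)
Definition form k h := [/\ measurable_fun setT h,
  forall t X, 0 < t -> h (t *: X) = t ^+ k * h X &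
  exists2 M, 0 <= M & forall X, `|h X| <= M * entry_norm X ^+ k].

Lemma entry_norm_ge0 X : 0 <= entry_norm X.
Proof. by apply: sumr_ge0 => i _; exact: sumr_ge0. Qed.

Lemma form_entry i j : form 1 (fun X => X i j).
Proof.
split=> [|t X _|]; first exact: measurable_entry.
  by rewrite mxE expr1.
exists 1 => // X.
rewrite mul1r expr1 /entry_norm (bigD1 i)//= (bigD1 j)//= -addrA.
by rewrite lerDl addr_ge0// ?sumr_ge0// => l _; exact: sumr_ge0.
Qed.

Lemma form_cst c : form 0 (fun=> c).
Proof.
split=> [|t X _|]; first exact: measurable_cst; first by rewrite mul1r.
by exists `|c| => // X; rewrite mulr1.
Qed.

Lemma formM k l h1 h2 : form k h1 -> form l h2 ->
  form (k + l) (fun X => h1 X * h2 X).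
Proof.
move=> [m1 z1 [M1 M10 b1]] [m2 z2 [M2 M20 b2]]; split.
- exact: measurable_funM.
- by move=> t X t0; rewrite z1// z2// exprD mulrACA.
- exists (M1 * M2); first exact: mulr_ge0.
  by move=> X; rewrite normrM exprD mulrACA ler_pM.
Qed.

Lemma formD k h1 h2 : form k h1 -> form k h2 -> form k (fun X => h1 X + h2 X).
Proof.
move=> [m1 z1 [M1 M10 b1]] [m2 z2 [M2 M20 b2]]; split.
- exact: measurable_funD.
- by move=> t X t0; rewrite z1// z2// mulrDr.
- exists (M1 + M2); first exact: addr_ge0.
  by move=> X; rewrite mulrDl (le_trans (ler_normD _ _))// lerD.
Qed.

Lemma form_sum k (I : Type) (r : seq I) (F : I -> 'M[R]_d -> R) :
  (forall i, form k (F i)) -> form k (fun X => \sum_(i <- r) F i X).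
Proof.
move=> fF; elim: r => [|i r IH].
  under eq_fun do rewrite big_nil.
  split=> [|t X _|]; [exact: measurable_cst|by rewrite mulr0|].
  by exists 0 => // X; rewrite normr0 mul0r.
by under eq_fun do rewrite big_cons; exact: formD.
Qed.

Lemma form_prod (I : Type) (r : seq I) (F : I -> 'M[R]_d -> R) :
  (forall i, form 1 (F i)) -> form (size r) (fun X => \prod_(i <- r) F i X).
Proof.
move=> fF; elim: r => [|i r IH].
  by under eq_fun do rewrite big_nil; exact: form_cst.
by under eq_fun do rewrite big_cons; rewrite /= -add1n; exact: formM.
Qed.

Lemma form_det : form d (fun X => \det X).
Proof.
apply: form_sum => s; rewrite -[d in form d]add0n; apply: formM.
  exact: form_cst.
have := @form_prod _ (index_enum 'I_d) (fun i X => X i (s i)).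
have -> : size (index_enum 'I_d) = d.
  by rewrite -sum1_size -[RHS]card_ord -sum1_card.
by apply => i; exact: form_entry.
Qed.

Lemma formX k h p : form k h -> form (p * k) (fun X => h X ^+ p).
Proof.
move=> fh; elim: p => [|p IH].
  by under eq_fun do rewrite expr0; rewrite mul0n; exact: form_cst.
by under eq_fun do rewrite exprS; rewrite mulSn; exact: formM.
Qed.

Lemma form_exp p i j : form p (fun X => (X ^+ p) i j).
Proof.
elim: p i j => [|p IH] i j.
  rewrite (_ : (fun _ => _) = fun=> (1%:M : 'M[R]_d) i j); first exact: form_cst.
  by apply/funext => X.
rewrite (_ : (fun _ => _) = fun X : 'M[R]_d => \sum_l X i l * (X ^+ p) l j).
  by apply: form_sum => l; rewrite -add1n; apply: formM => //; exact: form_entry.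
by apply/funext => X; rewrite exprS -[(X * X ^+ p)]/(X *m X ^+ p) mxE.
Qed.

Lemma form_tens p i j : (0 < p)%N ->
  form p (fun X => mxtens.ntensmx X p i j).
Proof.
(* [ntensmx_rec X p] is the tensor power of order p + 1, so the recursion starts from X itself and
   splits off one entry of X per step. *)
case: p i j => // p i j _; rewrite /mxtens.ntensmx.
elim: p i j => [|p IH] i j; first exact: form_entry.
rewrite (_ : (fun _ => _) = fun X : 'M[R]_d =>
  X (mxtens.mxtens_unindex i).1 (mxtens.mxtens_unindex j).1 *
  mxtens.ntensmx_rec X p (mxtens.mxtens_unindex i).2 (mxtens.mxtens_unindex j).2).
  by rewrite -[p.+2]add1n; apply: formM => //; exact: form_entry.
by apply/funext => X; rewrite [LHS]mxE.
Qed.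

End forms.

(** * Bounds of entries by traces on the cone *)

Section form_bound.
Context {R : realType} (d : nat).

(** Testing positivity on e_i + e_j and e_i - e_j gives 2 |X_ij| <= X_ii + X_jj, and each diagonal
    entry is at most the trace. *)
Lemma posdef_entry_le (X : 'M[R]_d) i j : posdef d X -> `|X i j| <= \tr X.
Proof.
move=> [Xs X0].
have ge0 (v : 'cV[R]_d) : 0 <= (v^T *m X *m v) 0 0.
  have [->|/X0/ltW//] := eqVneq v 0.
  by rewrite mulmx0 mxE.
have dE k l :
    ((delta_mx k 0 : 'cV[R]_d)^T *m X *m (delta_mx l 0 : 'cV[R]_d)) 0 0 = X k l.
  by rewrite trmx_delta -rowE -colE !mxE.
have addE (A B : 'M[R]_1) : (A + B) 0 0 = A 0 0 + B 0 0 by rewrite mxE.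
have subE (A B : 'M[R]_1) : (A - B) 0 0 = A 0 0 - B 0 0 by rewrite !mxE.
have Xkk k : 0 <= X k k by rewrite -dE ge0.
have XC : X j i = X i j by rewrite -{1}Xs mxE.
have Xp : 0 <= X i i + X j j + 2 * X i j.
  have := ge0 (delta_mx i 0 + delta_mx j 0).
  by rewrite [(_ + _)^T]linearD/= !mulmxDl !mulmxDr !addE !dE XC; lra.
have Xm : 0 <= X i i + X j j - 2 * X i j.
  have := ge0 (delta_mx i 0 - delta_mx j 0).
  by rewrite [(_ - _)^T]linearB/= !mulmxBl !mulmxBr !subE !dE XC; lra.
have Xt k : X k k <= \tr X.
  by rewrite /mxtrace (bigD1 k)//= lerDl sumr_ge0.
by rewrite ler_norml; have := Xt i; have := Xt j; lra.
Qed.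

(** With Sigma = C C^T and X = C Y C^T, the entries of Y are bounded by tr Y = tr(Sigma^-1 X); the
    constant collects the products of entries of C. *)
Lemma entry_norm_le (Sigma : 'M[R]_d) : posdef d Sigma ->
  exists2 M, 0 <= M & forall X, posdef d X ->
    entry_norm X <= M * \tr (invmx Sigma *m X).
Proof.
move=> /cholesky[C CT SE]; have Cu := pos_trig_unit CT.
pose M i j : R := \sum_k \sum_l `|C i l| * `|C j k|.
have M0 i j : 0 <= M i j.
  by apply: sumr_ge0 => k _; apply: sumr_ge0 => l _; rewrite mulr_ge0.
exists (\sum_i \sum_j M i j) => [|X Xp].
  by apply: sumr_ge0 => i _; exact: sumr_ge0.
rewrite SE mxtrace_invmx_mul_tr//.
set Y := invmx C *m X *m (invmx C)^T.
have Yp : posdef d Y by apply: posdef_congr => //; rewrite unitmx_inv.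
have XE : X = C *m Y *m C^T.
  by rewrite /Y !mulmxA mulmxV// mul1mx -mulmxA -trmx_mul mulmxV// trmx1 mulmx1.
rewrite mulr_suml; apply: ler_sum => i _; rewrite mulr_suml.
apply: ler_sum => j _; rewrite {1}XE mxE (le_trans (ler_norm_sum _ _ _))//.
rewrite mulr_suml; apply: ler_sum => k _; rewrite !mxE normrM mulr_suml.
rewrite (le_trans (ler_wpM2r _ (ler_norm_sum _ _ _)))// mulr_suml.
apply: ler_sum => l _; rewrite normrM mulrAC ler_wpM2l ?mulr_ge0//.
exact: posdef_entry_le.
Qed.

End form_bound.

(** * Wishart expectations and Levy integrals *)

Section Levy_Wishart.
Context {R : realType} (d : nat) (eta omega : R) (Sigma : 'M[R]_d.+1).
Hypotheses (eta_gt : (d.+1%:R - 1) / 2 < eta) (omega_gt0 : 0 < omega)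
  (Sigma_posdef : posdef d.+1 Sigma).
Implicit Types h : 'M[R]_d.+1 -> R.

Let s (X : 'M[R]_d.+1) : R := \tr (invmx Sigma *m X).
Let a : R := eta * d.+1%:R.
Let g := AGamma_levy_density eta omega Sigma.
Let f := Wishart_density (2 * eta) Sigma.
Let cg : R := AGamma_cst d.+1 eta omega / \det Sigma `^ eta.
Let cW : R := (2 `^ a * mvGamma d.+1 eta * \det Sigma `^ eta)^-1.

Let eta_gt0 : 0 < eta.
Proof.
apply: le_lt_trans eta_gt; rewrite -natr1 addrK.
by rewrite divr_ge0.
Qed.

Let a_gt0 : 0 < a.
Proof. by rewrite mulr_gt0// ltr0n. Qed.

Let G_gt0 : 0 < mvGamma d.+1 eta.
Proof. exact: mvGamma_gt0. Qed.

Let detS_gt0 : 0 < \det Sigma `^ eta.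
Proof. exact/powR_gt0/posdef_det_gt0. Qed.

Let cg_ge0 : 0 <= cg.
Proof.
rewrite divr_ge0 ?(ltW detS_gt0)// mulr_ge0 ?(ltW omega_gt0)//.
by rewrite divr_ge0 ?(ltW G_gt0)// ltW// Gamma_gt0.
Qed.

Let cW_gt0 : 0 < cW.
Proof. by rewrite invr_gt0 !mulr_gt0// powR_gt0. Qed.

Let gE X : g X = cg * (expR (- s X) / s X `^ a) *
  \det X `^ (eta - (d.+1%:R + 1) / 2).
Proof. by []. Qed.

Let fE X : f X = cW * expR (- (2^-1 * s X)) *
  \det X `^ (eta - (d.+1%:R + 1) / 2).
Proof.
rewrite /f /Wishart_density /cW /a /s div1r mulNr.
have -> : 2 * eta / 2 = eta by field.
have -> : d.+1%:R * (2 * eta) / 2 = eta * d.+1%:R by field.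
by congr (_ * _ * _ `^ _); field.
Qed.

Let f_ge0 X : 0 <= f X.
Proof.
rewrite fE; apply: mulr_ge0; last exact: powR_ge0.
by apply: mulr_ge0; [exact: ltW|exact: expR_ge0].
Qed.

Let g_ge0 X : 0 <= g X.
Proof.
rewrite gE; apply: mulr_ge0; last exact: powR_ge0.
by apply: mulr_ge0 => //; rewrite divr_ge0 ?expR_ge0 ?powR_ge0.
Qed.

Let ms : measurable_fun setT s.
Proof. by apply: measurable_mxtrace; exact: measurable_mulmx. Qed.

Let mdet : measurable_fun setT
  (fun X : 'M[R]_d.+1 => \det X `^ (eta - (d.+1%:R + 1) / 2)).
Proof.
apply: (@measurableT_comp _ _ _ _ _ _ (fun x : R => x `^ _)).
  exact: measurable_powR.
by apply: measurable_det; exact: measurable_id.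
Qed.

Let mf : measurable_fun setT f.
Proof.
rewrite (funext fE); apply: measurable_funM => //; apply: measurable_funM => //.
apply: measurableT_comp => //; apply: measurableT_comp => //.
exact: measurable_funM.
Qed.

Let mg : measurable_fun setT g.
Proof.
rewrite (funext gE); apply: measurable_funM => //; apply: measurable_funM => //.
rewrite (_ : (fun _ => _) = fun X => expR (- s X) * s X `^ (- a)).
  apply: measurable_funM.
    by apply: measurableT_comp => //; exact: measurableT_comp.
  by apply: (@measurableT_comp _ _ _ _ _ _ (fun x : R => x `^ _)) => //;
    exact: measurable_powR.
by apply/funext => X; rewrite powRN.
Qed.

Local Open Scope ereal_scope.

Let integral_Wishart h : measurable_fun setT h -> (forall X, 0 <= h X)%R ->
  \int[lebesgue_sym d.+1]_(X in posdef d.+1) (h X * f X)%:E =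
  cW%:E * cone_integral eta (fun X => (h X * expR (- (2^-1 * s X)))%:E).
Proof.
move=> mh h0; rewrite -ge0_cone_integralZl ?(ltW cW_gt0)//.
- rewrite -integral_posdef; apply: eq_integral => X _; rewrite fE.
  by congr (_%:E); ring.
- apply/measurable_EFinP; apply: measurable_funM => //.
  apply: measurableT_comp => //; apply: measurableT_comp => //.
  exact: measurable_funM.
- by move=> X; rewrite lee_fin mulr_ge0// expR_ge0.
Qed.

(** Both integrals are multiples of the same A = int h e^-s |X|^(eta-(d+1)/2) dX, with d here the
    matrix size. *)
Let integral_Levy h k : (0 < k)%N ->
  measurable_fun setT h -> (forall X, 0 <= h X)%R ->
  (forall t X, 0 < t -> h (t *: X) = t ^+ k * h X)%R ->
  \int[lebesgue_sym d.+1]_(X in posdef d.+1) (h X * g X)%:E =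
  (omega / 2 ^+ k * Beta a k%:R)%:E *
  \int[lebesgue_sym d.+1]_(X in posdef d.+1) (h X * f X)%:E.
Proof.
move=> k0 mh h0 hZ.
have Ga := Gamma_gt0 a_gt0.
pose J := cone_integral eta (fun X => (h X * (expR (- s X) / s X `^ a))%:E).
pose A := cone_integral eta (fun X => (h X * expR (- s X))%:E).
have JA : J = (Beta a k%:R / Gamma a)%:E * A.
  have E := cone_integral_homogeneous eta_gt0 k0 Sigma_posdef mh h0 hZ.
  rewrite mulrC EFinM -muleA /A -E muleA -EFinM mulVf ?mul1e// gt_eqF//.
have -> : \int[lebesgue_sym d.+1]_(X in posdef d.+1) (h X * g X)%:E = cg%:E * J.
  rewrite -ge0_cone_integralZl//.
  - rewrite -integral_posdef; apply: eq_integral => X _; rewrite gE.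
    by congr (_%:E); rewrite mulrA; congr (_ * _)%R; rewrite mulrCA.
  - apply/measurable_EFinP; apply: measurable_funM => //.
    rewrite (_ : (fun _ => _) = fun X => (expR (- s X) * s X `^ (- a))%R).
      apply: measurable_funM.
        by apply: measurableT_comp => //; exact: measurableT_comp.
      by apply: (@measurableT_comp _ _ _ _ _ _ (fun x : R => x `^ _)%R) => //;
        exact: measurable_powR.
    by apply/funext => X; rewrite powRN.
  - by move=> X; rewrite lee_fin mulr_ge0// divr_ge0 ?expR_ge0 ?powR_ge0.
rewrite integral_Wishart//.
pose H (X : 'M[R]_d.+1) := (h X * expR (- s X))%:E.
have mH : measurable_fun setT H.
  apply/measurable_EFinP; apply: measurable_funM => //.
  by apply: measurableT_comp => //; exact: measurableT_comp.
have H0 X : 0 <= H X by rewrite lee_fin mulr_ge0// expR_ge0.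
have half0 : (0 < 2^-1 :> R)%R by rewrite invr_gt0.
(* Rescaling by 1/2 turns e^-s into the Wishart weight: 2^k comes from [h], and 2^a from the
   density. The latter cancels in [cW], which leaves the 2^-k of the statement. *)
have -> : cone_integral eta (fun X => (h X * expR (- (2^-1 * s X)))%:E) =
    (2 ^+ k * 2 `^ a)%:E * A.
  transitivity (cone_integral eta (fun X => (2 ^+ k)%:E * H (2^-1 *: X)%R)).
    apply: eq_cone_integral => X _; rewrite /H hZ// -EFinM; congr (_%:E).
    rewrite !mulrA -exprMn mulfV// expr1n mul1r.
    by rewrite /s -scalemxAr mxtraceZ.
  have mHt : measurable_fun setT (fun X : 'M[R]_d.+1 => H (2^-1 *: X)%R).
    by apply: measurableT_comp mH _; exact: measurable_scalemx.
  have c0 : (0 <= 2 ^+ k :> R)%R by exact: exprn_ge0.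
  rewrite (ge0_cone_integralZl eta c0 mHt (fun X => H0 _)).
  rewrite (cone_integral_scale eta half0 mH H0) muleA -EFinM.
  congr ((_ * _)%:E * _).
  by rewrite -powR_inv1// -powRrM mulN1r opprK.
rewrite JA !muleA -!EFinM; congr (_%:E * _).
rewrite /cg /AGamma_cst /cW -/a.
have u1 : (Gamma a != 0)%R by rewrite gt_eqF.
have u2 : (mvGamma d.+1 eta != 0)%R by rewrite gt_eqF.
have u3 : (\det Sigma `^ eta != 0)%R by rewrite gt_eqF.
have u4 : (2 `^ a != 0 :> R)%R by rewrite gt_eqF// powR_gt0.
have u5 : (2 ^+ k != 0 :> R)%R by rewrite expf_neq0.
move: (Beta _ _) (Gamma _) (mvGamma _ _) (\det _ `^ _)%R (2 `^ a)%R (2 ^+ k)%R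
  u1 u2 u3 u4 u5 => u6 u7 u8 u9 u10 u11 u1 u2 u3 u4 u5.
by field; rewrite u1 u2 u3 u4 u5.
Qed.

(** Half of the decay e^(-s/2) absorbs the growth of [h], and the remaining e^(-s/4) has a finite
    cone integral. *)
Let integral_Wishart_lty h k : form k h ->
  \int[lebesgue_sym d.+1]_(X in posdef d.+1) (`|h X| * f X)%:E < +oo.
Proof.
move=> [mh _ [M M0 hM]]; rewrite integral_Wishart//; last exact: measurableT_comp.
have [N N0 sN] := entry_norm_le Sigma_posdef.
(* [M] is the constant of the form, [N] bounds the entries by s, and k! 4^k comes from (s/4)^k / k!
   <= e^(s/4). *)
pose c : R := (M * N ^+ k * (k`!%:R * 4 ^+ k))%R.
have c0 : (0 <= c)%R by rewrite !mulr_ge0 ?exprn_ge0// ler0n.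
have q0 : (0 < 4^-1 :> R)%R by rewrite invr_gt0.
rewrite lte_mul_pinfty ?lee_fin ?(ltW cW_gt0)//.
apply: (@le_lt_trans _ _
    (cone_integral eta (fun X => c%:E * (expR (- (4^-1 * s X)))%:E))); last first.
  rewrite ge0_cone_integralZl//.
  - by rewrite cone_integral_expR// -EFinM ltry.
  - exact: measurable_expR_trace_mul.
apply: ge0_le_integral => //.
- move=> X _.
  by rewrite mule_ge0// lee_fin ?cone_density_ge0// mulr_ge0// expR_ge0.
- apply: measurable_cone_integrand.
  apply/measurable_EFinP; apply: measurable_funM; first exact: measurableT_comp.
  apply: measurableT_comp => //; apply: measurableT_comp => //.
  exact: measurable_funM.
- apply: measurable_cone_integrand; apply: emeasurable_funM => //.
  exact: measurable_expR_trace_mul.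
move=> X _; rewrite /cone_density indicE.
have [/set_mem Xp|_] := boolP (X \in posdef d.+1); last by rewrite !mul0r !mul0e.
apply: lee_wpmul2l; first by rewrite lee_fin mul1r powR_ge0.
rewrite -EFinM lee_fin.
have s0 : (0 <= s X)%R.
  have := entry_norm_ge0 X; move: (sN _ Xp) => /[swap] /le_trans /[apply].
  (* When [N] is 0 the bound says nothing about the sign of [s X], and positivity of the trace is
     used directly. *)
  have [->|N1] := eqVneq N 0%R; last first.
    by rewrite pmulr_rge0// lt_neqAle eq_sym N1.
  move=> _; have [C CT SE] := cholesky Sigma_posdef.
  have Cu := pos_trig_unit CT.
  rewrite /s SE mxtrace_invmx_mul_tr//; apply/ltW/posdef_trace_gt0.
  by apply: posdef_congr => //; rewrite unitmx_inv.
have skE : (s X ^+ k <= k`!%:R * 4 ^+ k * expR (4^-1 * s X))%R.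
  have q4 : (0 <= 4^-1 * s X)%R by rewrite mulr_ge0.
  have : ((4^-1 * s X) ^+ k / k`!%:R <= expR (4^-1 * s X))%R.
    case: (k) => [|l].
      by rewrite expr0 fact0 divr1 (le_trans _ (expR_ge1Dx _))// lerDl.
    by apply: le_trans _ (expR_ge1Dxn l q4); rewrite lerDr.
  rewrite ler_pdivrMr ?ltr0n ?fact_gt0// exprMn exprVn.
  rewrite ler_pdivrMl ?exprn_gt0// => /le_trans; apply.
  by rewrite mulrA [X in (X <= _)%R]mulrC mulrA.
rewrite /c.
have -> : (expR (- (4^-1 * s X)) =
    expR (4^-1 * s X) * expR (- (2^-1 * s X)))%R.
  by rewrite -expRD; congr expR; field.
rewrite !mulrA ler_pM2r ?expR_gt0//.
apply: le_trans (hM X) _; rewrite -!mulrA ler_wpM2l//.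
apply: (@le_trans _ _ (N ^+ k * s X ^+ k)%R).
  by rewrite -exprMn lerXn2r ?nnegrE ?entry_norm_ge0 ?mulr_ge0// sN.
by rewrite ler_wpM2l ?exprn_ge0// mulrA.
Qed.

Section expectation.
Context (dT : measure_display) (T : measurableType dT) (P : probability T R)
  (W : {RV P >-> 'M[R]_d.+1}).
Hypothesis W_Wishart : is_Wishart W (2 * eta) Sigma.

Let ge0_Wishart_expectation h :
  measurable_fun setT h -> (forall X, 0 <= h X)%R ->
  \int[P]_w (h (W w))%:E =
  \int[lebesgue_sym d.+1]_(X in posdef d.+1) (h X * f X)%:E.
Proof.
move=> mh h0.
have mhE : measurable_fun setT (EFin \o h) by exact/measurable_EFinP.
rewrite -(ge0_integral_distribution W mhE); last by move=> X; rewrite lee_fin.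
rewrite (@ge0_integral_density _ _ _ (lebesgue_sym d.+1) _
  (fun X => \1_(posdef d.+1) X * f X)%R).
- rewrite [RHS]integral_mkcond; apply: eq_integral => X _.
  rewrite patchE /= indicE -EFinM.
  by case: ifP => _; rewrite ?mul0r// mul1r mulrC.
- apply: measurable_funM => //; apply: measurable_indic.
  exact: measurable_posdef.
- by move=> X; rewrite mulr_ge0// indicE ler0n.
- move=> A mA; apply: etrans (W_Wishart mA) _; rewrite integral_mkcondr.
  apply: eq_integral => X _; rewrite patchE indicE.
  by case: ifP => _; rewrite ?mul1r ?mul0r.
- exact: mhE.
- by move=> X; rewrite lee_fin.
Qed.

(** Homogeneity under t > 0 passes to positive parts, so signed forms reduce to the nonnegative case
    by h = h^+ - h^-, where h^- is the positive part of -h. *)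
Let pos_part h X := Num.max (h X) 0%R.

Let form_pos_part k h (fh : form k h) :
  [/\ measurable_fun setT (pos_part h), (forall X, 0 <= pos_part h X)%R &
    (forall t X, 0 < t -> pos_part h (t *: X) = t ^+ k * pos_part h X)%R].
Proof.
have [mh hZ _] := fh; split.
- exact: measurable_maxr.
- by move=> X; rewrite le_max lexx orbT.
- move=> t X t0; rewrite /pos_part hZ// maxr_pMr ?mulr0// exprn_ge0//.
  exact: ltW.
Qed.

Let formN k h : form k h -> form k (fun X => - h X)%R.
Proof.
move=> [mh hZ [M M0 hM]]; split.
- exact: measurableT_comp.
- by move=> t X t0; rewrite hZ// mulrN.
- by exists M => // X; rewrite normrN.
Qed.

Let pos_part_lty k h : form k h ->
  \int[lebesgue_sym d.+1]_(X in posdef d.+1) (pos_part h X * f X)%:E < +oo.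
Proof.
move=> fh; have [mp p0 _] := form_pos_part fh; have [mh _ _] := fh.
apply: le_lt_trans (integral_Wishart_lty fh).
apply: ge0_le_integral; first exact: measurable_posdef.
- by move=> X _; rewrite lee_fin mulr_ge0.
- by apply/measurable_EFinP/measurable_funTS; exact: measurable_funM.
- apply/measurable_EFinP/measurable_funTS; apply: measurable_funM => //.
  exact: measurableT_comp.
- move=> X _; rewrite lee_fin ler_wpM2r// /pos_part ge_max normr_ge0 andbT.
  exact: ler_norm.
Qed.

Let integral_posdef_form h w : (forall X, 0 <= w X)%R ->
  \int[lebesgue_sym d.+1]_(X in posdef d.+1) (h X * w X)%:E =
  \int[lebesgue_sym d.+1]_(X in posdef d.+1) (pos_part h X * w X)%:E -
  \int[lebesgue_sym d.+1]_(X in posdef d.+1)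
    (pos_part (fun X => - h X)%R X * w X)%:E.
Proof.
move=> w0; rewrite integralE; congr (_ - _); apply: eq_integral => X _.
  by rewrite funeposE -EFin_max maxr_pMl// mul0r.
by rewrite funenegE -EFinN -EFin_max maxr_pMl// mul0r mulNr.
Qed.

Lemma Wishart_expectation k h : form k h ->
  \int[P]_w (h (W w))%:E =
  \int[lebesgue_sym d.+1]_(X in posdef d.+1) (h X * f X)%:E.
Proof.
move=> fh; rewrite (integral_posdef_form h f_ge0).
transitivity (\int[P]_w (pos_part h (W w))%:E -
    \int[P]_w (pos_part (fun X => - h X)%R (W w))%:E).
  rewrite [LHS]integralE; congr (_ - _); apply: eq_integral => w _.
    by rewrite funeposE -EFin_max.
  by rewrite funenegE -EFinN -EFin_max.
have [mp p0 _] := form_pos_part fh; have [mn n0 _] := form_pos_part (formN fh).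
by rewrite !ge0_Wishart_expectation.
Qed.

Lemma Wishart_integrable k h : form k h ->
  P.-integrable setT (fun w => (h (W w))%:E).
Proof.
move=> fh; have [mh _ _] := fh; apply/integrableP; split.
  apply/measurable_EFinP; exact: measurableT_comp.
under eq_integral do rewrite abse_EFin.
rewrite (ge0_Wishart_expectation (h := fun X => `|h X|)%R)//.
  exact: integral_Wishart_lty fh.
exact: measurableT_comp.
Qed.

Lemma Levy_expectation k h : (0 < k)%N -> form k h ->
  \int[lebesgue_sym d.+1]_(X in posdef d.+1) (h X * g X)%:E =
  (omega / 2 ^+ k * Beta a k%:R)%:E * \int[P]_w (h (W w))%:E.
Proof.
move=> k0 fh; rewrite (Wishart_expectation fh).
rewrite (integral_posdef_form h g_ge0) (integral_posdef_form h f_ge0).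
have [mp p0 pZ] := form_pos_part fh.
have [mn n0 nZ] := form_pos_part (formN fh).
rewrite !(integral_Levy k0)// -muleBr//.
(* Factoring the constant out of the difference requires that it is not oo - oo; the Wishart
   integral of the positive part is finite. *)
apply: fin_num_adde_defr; rewrite ge0_fin_numE; first exact: pos_part_lty fh.
by apply: integral_ge0 => X _; rewrite lee_fin mulr_ge0.
Qed.

Lemma Levy_integrable k h : (0 < k)%N -> form k h ->
  (lebesgue_sym d.+1).-integrable (posdef d.+1) (fun X => (h X * g X)%:E).
Proof.
move=> k0 fh; have [mh hZ _] := fh; apply/integrableP; split.
  by apply/measurable_EFinP/measurable_funTS; exact: measurable_funM.
under eq_integral do rewrite abse_EFin normrM (ger0_norm (g_ge0 _)).
have mnh : measurable_fun setT (fun X => `|h X|)%R by exact: measurableT_comp.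
rewrite (integral_Levy k0 mnh)//; last first.
  by move=> t X t0; rewrite hZ// normrM ger0_norm// exprn_ge0// ltW.
rewrite lte_mul_pinfty ?lee_fin//; last exact: integral_Wishart_lty fh.
have kR : (0 < k%:R :> R)%R by rewrite ltr0n.
apply: mulr_ge0; first by rewrite divr_ge0 ?(ltW omega_gt0).
by apply/ltW/divr_gt0; rewrite ?mulr_gt0// ?Gamma_gt0// addr_gt0.
Qed.

(** The factor |X|^p only shifts the parameter of the cone density from eta to eta + p, so the
    moment is a ratio of two normalizing constants. *)
Lemma Wishart_det_expectation p :
  \int[P]_w (\det (W w) ^+ p)%:E =
  (2 ^+ (p * d.+1) * (mvGamma d.+1 (eta + p%:R) / mvGamma d.+1 eta) *
    \det Sigma ^+ p)%:E.
Proof.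
have fd : form (p * d.+1) (fun X : 'M[R]_d.+1 => \det X ^+ p)%R.
  exact/formX/form_det.
rewrite (Wishart_expectation fd).
have S0 := posdef_det_gt0 Sigma_posdef.
have etap : ((d.+1%:R - 1) / 2 < eta + p%:R)%R.
  by rewrite (lt_le_trans eta_gt)// lerDl ler0n.
have half0 : (0 < 2^-1 :> R)%R by rewrite invr_gt0.
transitivity (cW%:E * cone_integral (eta + p%:R)
    (fun X => (expR (- (2^-1 * s X)))%:E)).
  have E0 (X : 'M[R]_d.+1) : 0 <= (expR (- (2^-1 * s X)))%:E.
    by rewrite lee_fin expR_ge0.
  rewrite -(ge0_cone_integralZl _ (ltW cW_gt0)
    (measurable_expR_trace_mul (invmx Sigma) 2^-1) E0).
  rewrite -integral_posdef; apply: eq_integral => X /set_mem Xp; rewrite fE.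
  have X0 := posdef_det_gt0 Xp; congr (_%:E).
  have -> : (eta + p%:R - (d.+1%:R + 1) / 2 =
      p%:R + (eta - (d.+1%:R + 1) / 2))%R by ring.
  rewrite [(\det X `^ (p%:R + _))%R]powRD; last by rewrite (gt_eqF X0) implybT.
  by rewrite powR_mulrn ?(ltW X0)//; ring.
rewrite cone_integral_expR// -EFinM; congr (_%:E).
rewrite [(\det Sigma `^ (eta + _))%R]powRD; last by rewrite (gt_eqF S0) implybT.
rewrite powR_mulrn ?(ltW S0)//.
(* The part 2^a belongs to parameter eta and cancels in [cW]; the shift by p leaves 2^(p(d+1)). *)
have -> : (2^-1 `^ (- ((eta + p%:R) * d.+1%:R)) =
    2 `^ a * 2 ^+ (p * d.+1) :> R)%R.
  rewrite -powR_inv1// -powRrM mulN1r opprK mulrDl -natrM powRD ?powR_mulrn//.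
  by rewrite pnatr_eq0 implybT.
have u2 : (mvGamma d.+1 eta != 0)%R by rewrite gt_eqF.
have u3 : (\det Sigma `^ eta != 0)%R by rewrite gt_eqF.
have u4 : (2 `^ a != 0 :> R)%R by rewrite gt_eqF// powR_gt0.
rewrite /cW.
move: (mvGamma _ eta) (mvGamma _ (_ + _)%R) (\det _ `^ _)%R (\det _ ^+ _)%R
  (2 `^ a)%R (2 ^+ _)%R u2 u3 u4 => u6 u7 u8 u9 u10 u11 u2 u3 u4.
by field; rewrite u2 u3 u4.
Qed.

End expectation.

End Levy_Wishart.

Lemma Levy_expectation_mx (R : realType) (d : nat) (eta omega : R)
    (Sigma : 'M[R]_d.+1) (dT : measure_display) (T : measurableType dT)
    (P : probability T R) (W : {RV P >-> 'M[R]_d.+1}) (k m n : nat)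
    (F : 'M[R]_d.+1 -> 'M[R]_(m, n)) :
  (d.+1%:R - 1) / 2 < eta -> 0 < omega -> posdef d.+1 Sigma ->
  is_Wishart W (2 * eta) Sigma -> (0 < k)%N ->
  (forall i j, form k (fun X => F X i j)) ->
  let g := AGamma_levy_density eta omega Sigma in
  [/\ mx_integrable (lebesgue_sym d.+1) (posdef d.+1) (fun X => g X *: F X),
      mx_integrable P [set: T] (fun w => F (W w)) &
      mx_integral (lebesgue_sym d.+1) (posdef d.+1) (fun X => g X *: F X) =
      (omega / 2 ^+ k * Beta (eta * d.+1%:R) k%:R) *:
        mx_expectation P (fun w => F (W w))].
Proof.
move=> eta_gt omega_gt0 Sp WW k0 fF g; split=> [i j|i j|].
- rewrite (_ : (fun _ => _) = (fun X => (F X i j * g X)%:E)).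
    exact: Levy_integrable (fF i j).
  by apply/funext => X; rewrite mxE mulrC.
- exact: (Wishart_integrable eta_gt Sp WW (fF i j)).
apply/matrixP => i j; rewrite !mxE /Rintegral.
rewrite (_ : (fun X => _) = (fun X => (F X i j * g X)%:E)); last first.
  by apply/funext => X; rewrite mxE mulrC.
rewrite (Levy_expectation eta_gt omega_gt0 Sp WW k0 (fF i j)).
(* [fine] is multiplicative on finite values, hence the appeal to integrability. *)
rewrite unlock fineM// integrable_fin_num//.
exact: (Wishart_integrable eta_gt Sp WW (fF i j)).
Qed.

(** Integrability accompanies a) and b) because [Rintegral] and [fine] also assign a value to
    divergent integrals; c) is an equality of extended reals whose common value is shown to be real.
    The form with [mvBeta] is stated for (d - 1) / 2 < p, where the integral Gamma_d(p) converges;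
    the last form, with Gamma_d(eta + p) / Gamma_d(eta), covers every p > 0. *)
Theorem proposition5p9 (R : realType) (d : nat) (eta omega : R)
    (Sigma : 'M[R]_d) (dT : measure_display) (T : measurableType dT)
    (P : probability T R) (W : {RV P >-> 'M[R]_d}) (p : nat)
    (d_ge1 : (1 <= d)%N) (eta_gt : (d%:R - 1) / 2 < eta) (omega_gt0 : 0 < omega)
    (Sigma_posdef : posdef d Sigma) (W_Wishart : is_Wishart W (2 * eta) Sigma)
    (p_gt0 : (0 < p)%N) :
  let g := AGamma_levy_density eta omega Sigma in
  let dX := lebesgue_sym d in
  let tensor_pow (X : 'M[R]_d) := mxtens.ntensmx X p in
  let Kp := omega / 2 ^+ p * Beta (eta * d%:R) p%:R in
  let Kpd := omega / 2 ^+ (p * d) * Beta (eta * d%:R) (p * d)%:R in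
  [/\ [/\ mx_integrable dX (posdef d) (fun X => g X *: X ^+ p),
          mx_integrable P [set: T] (fun w => W w ^+ p) &
          mx_integral dX (posdef d) (fun X => g X *: X ^+ p) =
          Kp *: mx_expectation P (fun w => W w ^+ p)],
      [/\ mx_integrable dX (posdef d) (fun X => g X *: tensor_pow X),
          mx_integrable P [set: T] (fun w => tensor_pow (W w)) &
          mx_integral dX (posdef d) (fun X => g X *: tensor_pow X) =
          Kp *: mx_expectation P (fun w => tensor_pow (W w))] &
      [/\ (\int[dX]_(X in posdef d) (\det X ^+ p * g X)%:E)%E =
          (Kpd%:E * 'E_P[(fun w => \det (W w) ^+ p)%R])%E,
          ((d%:R - 1) / 2 < p%:R :> R) ->
          (Kpd%:E * 'E_P[(fun w => \det (W w) ^+ p)%R])%E =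
          (omega * mvGamma d p%:R *
             (Beta (eta * d%:R) (p * d)%:R / mvBeta d eta p%:R) *
             \det Sigma ^+ p)%:E &
          (Kpd%:E * 'E_P[(fun w => \det (W w) ^+ p)%R])%E =
          (omega * (mvGamma d (eta + p%:R) / mvGamma d eta) *
             Beta (eta * d%:R) (p * d)%:R * \det Sigma ^+ p)%:E]].
Proof.
case: d Sigma W d_ge1 eta_gt Sigma_posdef W_Wishart => // d Sigma W _ eta_gt
  Sigma_posdef W_Wishart g dX tensor_pow Kp Kpd.
have EdetE : 'E_P[(fun w => \det (W w) ^+ p)%R]%E =
    (\int[P]_w (\det (W w) ^+ p)%:E)%E by rewrite unlock.
have B_gt0 : 0 < Beta (eta * d.+1%:R) (p * d.+1)%:R.
  have pd0 : 0 < (p * d.+1)%:R :> R by rewrite ltr0n muln_gt0 p_gt0.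
  have ed0 : 0 < eta * d.+1%:R.
    rewrite mulr_gt0 ?ltr0n//; apply: le_lt_trans eta_gt.
    by rewrite -natr1 addrK divr_ge0.
  by apply: divr_gt0; rewrite ?mulr_gt0 ?Gamma_gt0// addr_gt0.
have Gp_gt0 : 0 < mvGamma d.+1 (eta + p%:R).
  by apply: mvGamma_gt0; rewrite (lt_le_trans eta_gt)// lerDl ler0n.
have G_gt0 := mvGamma_gt0 eta_gt.
have EdetF : (Kpd%:E * 'E_P[(fun w => \det (W w) ^+ p)%R] =
    (omega * (mvGamma d.+1 (eta + p%:R) / mvGamma d.+1 eta) *
       Beta (eta * d.+1%:R) (p * d.+1)%:R * \det Sigma ^+ p)%:E)%E.
  rewrite EdetE (Wishart_det_expectation eta_gt Sigma_posdef W_Wishart) -EFinM.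
  congr (_%:E); rewrite /Kpd; have := gt_eqF G_gt0.
  have : 2 ^+ (p * d.+1) != 0 :> R by rewrite expf_neq0.
  move: (Beta _ _) (mvGamma _ (_ + _)) (mvGamma _ eta) (2 ^+ _) (\det _ ^+ _).
  by move=> u v w x y x0 w0; field; rewrite x0 w0.
split.
- exact: (Levy_expectation_mx eta_gt omega_gt0 Sigma_posdef W_Wishart p_gt0
    (fun i j => form_exp p i j)).
- exact: (Levy_expectation_mx eta_gt omega_gt0 Sigma_posdef W_Wishart p_gt0
    (fun i j => form_tens i j p_gt0)).
split=> //.
- rewrite EdetE /Kpd /g.
  apply: (Levy_expectation eta_gt omega_gt0 Sigma_posdef W_Wishart).
    by rewrite muln_gt0 p_gt0.
  exact/formX/form_det.
(* The bound on p makes Gamma_d(p) positive, so it cancels between [mvGamma] and [mvBeta]. *)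
- move=> /mvGamma_gt0 Gp0; rewrite EdetF /mvBeta; congr (_%:E).
  move: (gt_eqF Gp_gt0) (gt_eqF Gp0) (gt_eqF G_gt0).
  move: (mvGamma _ (_ + _)) (mvGamma _ p%:R) (mvGamma _ eta) (Beta _ _) (_ ^+ _).
  by move=> u v w x y u0 v0 w0; field; rewrite u0 v0 w0.
Qed.
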